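(* For any constant $c \ne 0$ and any real analytic Riemannian surface $(M, g)$ (of dimension $2$), there is an atlas $\{(U_\alpha, \varphi_\alpha)\}_{\alpha \in I}$ of $M$ such that for every $\alpha \in I$ there is a real analytic function $\epsilon(x_1, x_2)$ on $\varphi_\alpha(U_\alpha) \subset \mathbb{R}^2$ such that, in the coordinates $(x_1,x_2)$ given by $\varphi_\alpha$, $$g|_{U_\alpha} = \frac{c^2}{\epsilon(x_1,x_2)}\, dx_1^2 + \epsilon(x_1,x_2)\, dx_2^2 .$$ Thus, for any isometry $\iota_\alpha : U_\alpha \to \iota_\alpha(U_\alpha) \subset \mathbb{R}^N$, the map $F := \iota_\alpha \circ \varphi_\alpha^{-1} : \varphi_\alpha(U_\alpha) \to \mathbb{R}^N$ satisfies both of the following, where $DF = (\partial F_i/\partial x_j)$ is its $N \times 2$ Jacobian matrix: ($\star$) ${}^t(DF)\, DF$ is an invertible diagonal matrix at every point of $\varphi_\alpha(U_\alpha)$; ($\star\star$) $\det\left({}^t(DF)\, DF\right)$ is constant on $\varphi_\alpha(U_\alpha)$, equal to the square of some nonzero constant.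
   Context: A real analytic Riemannian surface is a real analytic $2$-manifold with a real analytic Riemannian metric; the charts of the atlas are charts of its real analytic structure. An isometry $\iota_\alpha: U_\alpha \to \iota_\alpha(U_\alpha) \subset \mathbb{R}^N$ is an isometric embedding of $(U_\alpha, g|_{U_\alpha})$ into $\mathbb{R}^N$ with its Euclidean metric. ${}^tX$ denotes the transpose of $X$. *)

(* Defs.v *)
From HB Require Import structures.
From mathcomp Require Import all_boot all_order all_algebra.
From mathcomp Require Import all_classical all_reals all_analysis.

Set Implicit Arguments.
Unset Strict Implicit.
Unset Printing Implicit Defensive.

Import Order.TTheory GRing.Theory Num.Theory.
Import numFieldNormedType.Exports.
Local Open Scope classical_set_scope.
Local Open Scope ring_scope.

(* Points of R^n are row vectors; the library norm on 'rV[R]_n is the sup norm,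
   which induces the Euclidean topology.  The coordinates x_1, x_2 of a point x
   of R^2 are x 0 0 and x 0 1. *)

Definition power_term (R : realType) (a : nat -> nat -> R) (h : 'rV[R]_2)
    (k : nat * nat) : R :=
  a k.1 k.2 * h 0 0 ^+ k.1 * h 0 1 ^+ k.2.

(* The double power series converges absolutely to f near p; absolute
   convergence makes the choice of the square partial sums immaterial. *)
Definition analytic_at (R : realType) (f : 'rV[R]_2 -> R) (p : 'rV[R]_2) :=
  exists a : nat -> nat -> R, \forall x \near p,
    summable [set: nat * nat] (fun k => (power_term a (x - p) k)%:E) /\
    (fun n : nat => \sum_(i < n) \sum_(j < n)
       power_term a (x - p) (i : nat, j : nat)) @ \oo --> f x.

Definition analytic_on (R : realType) (U : set 'rV[R]_2) (f : 'rV[R]_2 -> R) :=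
  forall p, U p -> analytic_at f p.

Definition partial (R : realType) (f : 'rV[R]_2 -> R) (j : 'I_2)
    (x : 'rV[R]_2) : R :=
  'D_(delta_mx 0 j) f x.

(* The N x 2 matrix (dF_i/dx_j), acting on column vectors; the library's
   'J F x uses row vectors and is the transpose of this matrix. *)
Definition Dmx (R : realType) (N : nat) (F : 'rV[R]_2 -> 'rV[R]_N)
    (x : 'rV[R]_2) : 'M[R]_(N, 2) :=
  \matrix_(i < N, j < 2) partial (fun y => F y 0 i) j x.

(* Meant for open U. *)
Definition C1_on (R : realType) (U : set 'rV[R]_2) (f : 'rV[R]_2 -> R) :=
  forall x, U x -> differentiable f x /\
    forall j, {for x, continuous (partial f j)}.

(* A homeomorphism between an open set of M and an open set of R^2, represented
   by total functions.  The values of chart_map outside chart_dom and those of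
   chart_inv outside chart_map @` chart_dom are irrelevant. *)
Record chart (R : realType) (M : topologicalType) := Chart {
  chart_dom : set M;
  chart_map : M -> 'rV[R]_2;
  chart_inv : 'rV[R]_2 -> M;
  chart_dom_open : open chart_dom;
  chart_cod_open : open (chart_map @` chart_dom);
  chart_map_continuous : {within chart_dom, continuous chart_map};
  chart_inv_continuous :
    {within chart_map @` chart_dom, continuous chart_inv};
  chart_mapK : forall m, chart_dom m -> chart_inv (chart_map m) = m
}.

Definition chart_cod (R : realType) (M : topologicalType) (phi : chart R M) :
    set 'rV[R]_2 :=
  chart_map phi @` chart_dom phi.

Definition transition (R : realType) (M : topologicalType)
    (phi psi : chart R M) : 'rV[R]_2 -> 'rV[R]_2 :=
  chart_map psi \o chart_inv phi.

Definition overlap (R : realType) (M : topologicalType)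
    (phi psi : chart R M) : set 'rV[R]_2 :=
  chart_map phi @` (chart_dom phi `&` chart_dom psi).

Definition compatible (R : realType) (M : topologicalType)
    (phi psi : chart R M) :=
  forall i : 'I_2,
    analytic_on (overlap phi psi) (fun x => transition phi psi x 0 i) /\
    analytic_on (overlap psi phi) (fun x => transition psi phi x 0 i).

Definition covers (R : realType) (M : topologicalType)
    (A : set (chart R M)) :=
  forall m : M, exists2 phi, A phi & chart_dom phi m.

Record analytic_surface (R : realType) := AnalyticSurface {
  surface_carrier :> topologicalType;
  surface_hausdorff : hausdorff_space surface_carrier;
  surface_second_countable : @second_countable surface_carrier;
  surface_atlas : set (chart R surface_carrier);
  surface_atlas_covers : covers surface_atlas;
  surface_atlas_compatible : forall phi psi,
    surface_atlas phi -> surface_atlas psi -> compatible phi psi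
}.

(* The charts of the real analytic structure, i.e. of the maximal atlas
   containing the given one. *)
Definition analytic_chart (R : realType) (M : analytic_surface R)
    (phi : chart R M) :=
  forall psi, surface_atlas psi -> compatible phi psi.

Definition is_atlas (R : realType) (M : analytic_surface R)
    (A : set (chart R M)) :=
  A `<=` @analytic_chart R M /\ covers A.

(* A real analytic field of positive definite symmetric 2-tensors, given by its
   matrix (g_ij) in every chart of the structure together with the tensor
   transformation rule; the values metric_mx phi x with phi not in the
   structure or x outside chart_cod phi are irrelevant. *)
Record riemannian_metric (R : realType) (M : analytic_surface R) :=
    RiemannianMetric {
  metric_mx :> chart R M -> 'rV[R]_2 -> 'M[R]_2;
  metric_analytic : forall phi, analytic_chart phi ->
    forall i j : 'I_2,
      analytic_on (chart_cod phi) (fun x => metric_mx phi x i j);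
  metric_sym : forall phi, analytic_chart phi ->
    forall x, chart_cod phi x -> (metric_mx phi x)^T = metric_mx phi x;
  metric_posdef : forall phi, analytic_chart phi ->
    forall x, chart_cod phi x -> forall v : 'cV[R]_2, v != 0 ->
      0 < (v^T *m metric_mx phi x *m v) 0 0;
  metric_change : forall phi psi, analytic_chart phi -> analytic_chart psi ->
    forall x, overlap phi psi x ->
      metric_mx phi x =
      (Dmx (transition phi psi) x)^T
        *m metric_mx psi (transition phi psi x)
        *m Dmx (transition phi psi) x
}.

(* An isometric embedding of (U, g|_U), U open in M, into Euclidean R^N: a C^1
   topological embedding pulling the Euclidean metric back to g.  It is an
   immersion because g is positive definite.  C^1 is the least regularity for
   which the pullback is a continuous tensor; smooth and real analytic
   isometric embeddings are included. *)
Record isometric_embedding (R : realType) (M : analytic_surface R)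
    (g : riemannian_metric M) (U : set M) (N : nat) (iota : M -> 'rV[R]_N) :
    Prop := IsometricEmbedding {
  isometric_C1 : forall psi : chart R M, analytic_chart psi ->
    forall i : 'I_N,
      C1_on (chart_map psi @` (U `&` chart_dom psi))
            (fun x => iota (chart_inv psi x) 0 i);
  isometric_injective : forall m n, U m -> U n -> iota m = iota n -> m = n;
  isometric_continuous : {within U, continuous iota};
  isometric_open_image : forall V : set M, open V -> V `<=` U ->
    exists2 W : set 'rV[R]_N, open W & iota @` V = (iota @` U) `&` W;
  isometric_pullback : forall psi : chart R M, analytic_chart psi ->
    forall x, (chart_map psi @` (U `&` chart_dom psi)) x ->
      (Dmx (iota \o chart_inv psi) x)^T *m Dmx (iota \o chart_inv psi) x =
      g psi x
}.

(* Main.v *)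
(* In a chart where the metric has matrix (g_ij) with determinant D, one looks
   for the inverse F of the new chart.  Orthogonality of F_1 = dF/dx_1 and
   F_2 = dF/dx_2, together with det(DF)^2 D = c^2, is the evolution equation
     F_2 = (c / sqrt D) (-(g_12 P + g_22 Q), g_11 P + g_12 Q) / g(F_1, F_1),
   (P, Q) = F_1, with Cauchy data F(x_1, 0) = p + (x_1, 0).  It is solved for
   w = F_2, F being p + (x_1, 0) plus the integral of w in x_2, by iterating on
   formal power series.  The iteration is causal in the x_2-degree, hence
   converges formally, and it preserves a ball of a weighted norm (Lax's form of
   Cauchy's majorants) in which d/dx_1 followed by integration in x_2 is small,
   so the formal solution converges.  The same scheme, graded by the total
   degree, gives the analytic inverse function theorem, which turns F into a
   chart.  With g_12 = 0 and det g = c^2 the function eps is g_22. *)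

Require Import Defs.
From HB Require Import structures.
From mathcomp Require Import all_boot all_order all_algebra.
From mathcomp Require Import all_classical all_reals all_analysis.
From mathcomp Require Import ring lra zify.
Import Order.TTheory GRing.Theory Num.Theory.
Import numFieldNormedType.Exports.
Set Implicit Arguments.
Unset Strict Implicit.
Unset Printing Implicit Defensive.
Local Open Scope classical_set_scope.
Local Open Scope ring_scope.

(** * Sums of geometrically dominated double families *)

Section DoubleSeries.
Context {R : realType}.
Implicit Types (s t : nat -> nat -> R) (B : R).

(** The right-hand side of the evolution equation is forced: the vector (-(g_12 P + g_22 Q), g_11 P
    + g_12 Q) is g-orthogonal to F_1 and its determinant with F_1 is g(F_1, F_1), so dividing by
    that and multiplying by c / sqrt D fixes both the direction and the Jacobian. The obstacle is
    the derivative F_1 on the right, an operation that is not bounded in the majorant norm. Solving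
    for [w] leaves it only under an integration in x_2, and separate rates [K] in x_1 and [L] in x_2
    charge the combined operator with the factor K / L. The bounds concern one coefficient at a
    time, so they pass to the coefficientwise limit of the iteration. The right-hand side has four
    arguments, the two components of F and of F_1, whereas power series here have two variables;
    [lifts] bridges this by recording how an operation acts on formal series, a notion closed under
    composition with analytic functions of two variables. *)

Definition sqsum s n := \sum_(i < n) \sum_(j < n) s i j.

Definition geo B s := forall i j, `|s i j| <= B * 2^-1 ^+ (i + j).

Definition dsum s : R := limn (sqsum s).

Lemma sqsumS s n :
  sqsum s n.+1 = sqsum s n + (\sum_(i < n) s i n + \sum_(j < n.+1) s n j).
Proof.
rewrite /sqsum big_ord_recr /= addrA; congr (_ + _).
by rewrite -big_split /=; apply: eq_bigr => i _; rewrite big_ord_recr.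
Qed.

Lemma sqsumD s t n : sqsum (fun i j => s i j + t i j) n = sqsum s n + sqsum t n.
Proof. by rewrite -big_split; apply: eq_bigr => i _; rewrite -big_split. Qed.

Lemma sqsumZ (k : R) s n : sqsum (fun i j => k * s i j) n = k * sqsum s n.
Proof. by rewrite mulr_sumr; apply: eq_bigr => i _; rewrite mulr_sumr. Qed.

Lemma sqsum_sub_le s t n m : (forall i j, `|s i j| <= t i j) -> (n <= m)%N ->
  `|sqsum s m - sqsum s n| <= sqsum t m - sqsum t n.
Proof.
move=> st /subnK <-; elim: (m - n)%N => [|k IH]; first by rewrite !subrr normr0.
rewrite addSn !sqsumS.
set X := _ + \sum_(j < _) s _ _; set Y := _ + \sum_(j < _) t _ _.
have XY : `|X| <= Y.
  rewrite (le_trans (ler_normD _ _))// lerD//;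
    by rewrite (le_trans (ler_norm_sum _ _ _))// ler_sum.
rewrite addrAC [leRHS]addrAC (le_trans (ler_normD _ _))//.
exact: lerD.
Qed.

Lemma sum_half n : \sum_(i < n) 2^-1 ^+ i = 2 - 2 * 2^-1 ^+ n :> R.
Proof.
elim: n => [|n IH]; first by rewrite big_ord0 expr0; lra.
by rewrite big_ord_recr /= IH exprS; lra.
Qed.

Lemma sqsum_half B n :
  sqsum (fun i j => B * 2^-1 ^+ (i + j)) n = B * (2 - 2 * 2^-1 ^+ n) ^+ 2.
Proof.
rewrite sqsumZ; congr (_ * _).
rewrite -sum_half expr2 /sqsum big_distrl; apply: eq_bigr => i _ /=.
by rewrite big_distrr; apply: eq_bigr => j _ /=; rewrite exprD.
Qed.

Lemma half_itv n : 0 < (2^-1 : R) ^+ n <= 1.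
Proof. by rewrite exprn_gt0 ?exprn_ile1//; lra. Qed.

Lemma geo_ge0 B s : geo B s -> 0 <= B.
Proof. by move=> /(_ 0 0)%N; rewrite expr0 mulr1; apply: le_trans. Qed.

(** The dominating family sums to B (2 - 2a)^2 on the square of side n, where a = 2^-n, and 4 - (2 -
    2a)^2 <= 8a gives the factor 8. The bound depends on [s] only through [B], which makes the tails
    uniform in [dsum_cvg]. *)
Lemma geo_sqsum_le B s n m : geo B s -> (n <= m)%N ->
  `|sqsum s m - sqsum s n| <= 8 * B * 2^-1 ^+ n.
Proof.
move=> gs nm; apply: le_trans (sqsum_sub_le gs nm) _; rewrite !sqsum_half.
have B0 := geo_ge0 gs.
have /andP[a0 a1] := half_itv n; have /andP[b0 b1] := half_itv m.
set a := _ ^+ n in a0 a1 *; set b := _ ^+ m in b0 b1 *.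
rewrite -mulrBr (_ : 8 * B * a = B * (8 * a)); last by ring.
by apply: ler_wpM2l => //; nra.
Qed.

Lemma geo_cvg B s : geo B s -> sqsum s @ \oo --> dsum s.
Proof.
move=> gs; have B0 := geo_ge0 gs.
pose t i j : R := B * 2^-1 ^+ (i + j).
have nd u : (forall i j, 0 <= u i j) -> nondecreasing_seq (sqsum u).
  move=> u0 n m nm; rewrite -subr_ge0.
  apply: le_trans (sqsum_sub_le (s := fun _ _ => 0) _ nm) => //.
  by move=> i j; rewrite normr0.
have tle n : sqsum t n <= 4 * B.
  rewrite sqsum_half mulrC ler_wpM2r//.
  by have /andP[a0 a1] := half_itv n; nra.
have t0 i j : 0 <= t i j by rewrite mulr_ge0// exprn_ge0.
have sle n : sqsum s n <= sqsum t n.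
  by apply: ler_sum => i _; apply: ler_sum => j _; apply: le_trans (gs i j); rewrite ler_norm.
have ct : cvgn (sqsum t).
  apply: nondecreasing_is_cvgn; first exact: nd.
  by exists (4 * B) => _ [n _ <-].
(* Adding the dominating family makes the terms nonnegative, so this sum and that of [t] converge by
   monotonicity; [s] is their difference. *)
have cvst : cvgn (fun n => sqsum (fun i j => s i j + t i j) n).
  apply: nondecreasing_is_cvgn.
    apply: nd => i j; have := gs i j; rewrite ler_norml => /andP[+ _].
    by rewrite /t; lra.
  exists (8 * B) => _ [n _ <-]; rewrite sqsumD.
  by have := sle n; have := tle n; lra.
have : cvgn (fun n => sqsum (fun i j => s i j + t i j) n - sqsum t n) by exact: is_cvgB.
by under eq_fun do rewrite sqsumD addrK.
Qed.

Lemma cvg_dsum s l : sqsum s @ \oo --> l -> dsum s = l.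
Proof. exact: cvg_lim. Qed.

Lemma dsum_tail B s n : geo B s -> `|dsum s - sqsum s n| <= 8 * B * 2^-1 ^+ n.
Proof.
move=> gs.
have c : `|sqsum s m - sqsum s n| @[m --> \oo] --> `|dsum s - sqsum s n|.
  by apply: cvg_norm; apply: cvgB; [exact: geo_cvg gs|exact: cvg_cst].
rewrite -(cvg_lim _ c)//; apply: limr_le; first by apply/cvg_ex; eexists; exact: c.
by exists n => // m /= nm; exact: geo_sqsum_le.
Qed.

Lemma dsum_le B s : geo B s -> `|dsum s| <= 8 * B.
Proof.
by move=> /(dsum_tail 0); rewrite /sqsum big_ord0 subr0 expr0 mulr1.
Qed.

Lemma geoD B B' s t : geo B s -> geo B' t -> geo (B + B') (fun i j => s i j + t i j).
Proof.
by move=> gs gt i j; rewrite mulrDl (le_trans (ler_normD _ _))// lerD.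
Qed.

Lemma geoZ B (k : R) s : geo B s -> geo (`|k| * B) (fun i j => k * s i j).
Proof. by move=> gs i j; rewrite normrM -mulrA ler_wpM2l. Qed.

Lemma dsumD B B' s t : geo B s -> geo B' t ->
  dsum (fun i j => s i j + t i j) = dsum s + dsum t.
Proof.
move=> gs gt; apply: cvg_dsum; rewrite (funext (sqsumD s t)).
by apply: cvgD; exact: geo_cvg.
Qed.

Lemma dsumZ B (k : R) s : geo B s -> dsum (fun i j => k * s i j) = k * dsum s.
Proof.
move=> gs; apply: cvg_dsum; rewrite (funext (sqsumZ k s)).
by apply: cvgMr; exact: geo_cvg.
Qed.

Lemma sqsum_fin s m n : (m <= n)%N ->
  (forall i j, (m <= i)%N || (m <= j)%N -> s i j = 0) -> sqsum s n = sqsum s m.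
Proof.
move=> /subnK <- s0; elim: (n - m)%N => [//|k IH].
rewrite addSn sqsumS IH !big1 ?addr0// => i _; rewrite s0// ?leq_addl ?orbT//.
Qed.

Lemma dsum_fin s m :
  (forall i j, (m <= i)%N || (m <= j)%N -> s i j = 0) -> dsum s = sqsum s m.
Proof.
move=> s0; apply: cvg_dsum.
apply: (@cvg_trans _ (sqsum s m @[_ --> \oo])); last exact: cvg_cst.
apply: near_eq_cvg; exists m => // n /= mn; by rewrite (sqsum_fin mn).
Qed.

(** Dominated convergence along a filter: a common [B] makes all tails beyond a fixed square small,
    and on the square the sum is finite. *)
Lemma dsum_cvg (T : Type) (F : set_system T) {FF : Filter F} B
    (u : T -> nat -> nat -> R) s :
  (\forall x \near F, geo B (u x)) -> geo B s ->
  (forall i j, u x i j @[x --> F] --> s i j) ->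
  dsum (u x) @[x --> F] --> dsum s.
Proof.
move=> gu gs us; apply/cvgrPdist_le => e e0.
have B0 := geo_ge0 gs.
have [n ne] : exists n, 8 * B * 2^-1 ^+ n <= e / 3.
  have : (8 * B) * (2^-1 : R) ^+ n @[n --> \oo] --> 8 * B * 0.
    by apply: cvgMr; apply: cvg_expr; rewrite ger0_norm; lra.
  rewrite mulr0 => /cvgrPdist_le /(_ (e / 3)) [|n _ /(_ n)/=]; first lra.
  rewrite sub0r normrN => /(_ (leqnn _)) h; exists n.
  by apply: le_trans h; rewrite ler_norm.
have : sqsum (u x) n @[x --> F] --> sqsum s n.
  apply: cvg_big => [|i _]; first exact: add_continuous.
  by apply: cvg_big => [|j _]; [exact: add_continuous|exact: us].
move=> /cvgrPdist_le /(_ (e / 3)) => /(_ ltac:(lra)) cu.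
near=> x.
have gux : geo B (u x) by near: x.
have : `|sqsum s n - sqsum (u x) n| <= e / 3 by near: x.
have := dsum_tail n gux; have := dsum_tail n gs.
rewrite !ler_norml => /andP[? ?] /andP[? ?] /andP[? ?].
by apply/andP; split; lra.
Unshelve. all: by end_near. Qed.

End DoubleSeries.

(** * Formal double power series and Lax's majorant *)

Section FormalSeries.
Context {R : realType}.
Implicit Types (a b s t : nat -> nat -> R) (A B K L : R) (h : 'rV[R]_2).

Definition fmul a b i j :=
  \sum_(p < i.+1) \sum_(q < j.+1) a p q * b (i - p)%N (j - q)%N.

Lemma sum_triangle (V : nmodType) (f : nat -> nat -> V) n :
  \sum_(i < n) \sum_(p < i.+1) f p (i - p)%N =
  \sum_(p < n) \sum_(k < n - p) f p k.
Proof.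
elim: n => [|n IH]; first by rewrite !big_ord0.
rewrite big_ord_recr /= IH [in RHS]big_ord_recr /= subSnn big_ord1.
rewrite [in LHS]big_ord_recr /= subnn addrA; congr (_ + _).
rewrite -big_split; apply: eq_bigr => p _ /=.
by rewrite subSn 1?ltnW// big_ord_recr.
Qed.

Definition rect t m k := \sum_(i < m) \sum_(j < k) t i j.

Definition trunc t m k i j := if (i < m)%N && (j < k)%N then t i j else 0.

Lemma geo_trunc B t m k : geo B t -> geo B (trunc t m k).
Proof.
move=> gt i j; rewrite /trunc; case: ifP => // _.
by rewrite normr0 mulr_ge0 ?(geo_ge0 gt)// exprn_ge0.
Qed.


Lemma dsum_trunc t m k : dsum (trunc t m k) = rect t m k.
Proof.
rewrite (@dsum_fin _ _ (maxn m k)); last first.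
  by move=> i j; rewrite !geq_max /trunc => h; case: ifP => // /andP[]; lia.
rewrite /sqsum /rect (big_ord_widen (maxn m k) (fun i => \sum_(j < k) t i j)) ?leq_maxl//.
rewrite [RHS]big_mkcond; apply: eq_bigr => i _ /=.
case: ifP => im; last by rewrite big1// => j _; rewrite /trunc im.
rewrite (big_ord_widen (maxn m k) (t i)) ?leq_maxr// [RHS]big_mkcond.
by apply: eq_bigr => j _; rewrite /trunc im.
Qed.

(** Rectangles shortened by fixed [p] and [q] are what the Cauchy product produces. As truncations
    of [t] they stabilise coefficientwise under the bound [B]. *)
Lemma rect_cvg B t p q : geo B t ->
  rect t (n - p)%N (n - q)%N @[n --> \oo] --> dsum t.
Proof.
move=> gt; under eq_fun do rewrite -dsum_trunc.
apply: (dsum_cvg (B := B)) => //; first by near=> n; exact: geo_trunc.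
move=> i j; apply: (@cvg_trans _ (t i j @[_ --> \oo])); last exact: cvg_cst.
apply: near_eq_cvg; exists (i + j + p + q).+1 => // n /= hn; rewrite /trunc.
by case: ifP => //; lia.
Unshelve. all: by end_near. Qed.

Lemma dsum_mul A B s t : geo A s -> geo B t -> dsum (fmul s t) = dsum s * dsum t.
Proof.
move=> gs gt; apply: cvg_dsum.
have B0 := geo_ge0 gt.
(* Regroup the square partial sum by the index (p, q) of [s]: the factor of [s p q] is a rectangle
   sum of [t], bounded by [8 * B] and tending to [dsum t], so dominated convergence applies. *)
have E n : sqsum (fmul s t) n = dsum (fun p q => s p q * rect t (n - p)%N (n - q)%N).
  rewrite (@dsum_fin _ _ n); last first.
    move=> p q /orP[] h; first by rewrite (eqP h) /rect big_ord0 mulr0.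
    by rewrite (eqP h) /rect big1 ?mulr0// => i _; rewrite big_ord0.
  transitivity (\sum_(i < n) \sum_(p < i.+1)
      \sum_(q < n) \sum_(k < n - q) s p q * t (i - p)%N k).
    apply: eq_bigr => i _; rewrite /fmul exchange_big /=.
    apply: eq_bigr => p _.
    by rewrite -(sum_triangle (fun q k => s p q * t (i - p)%N k)).
  rewrite (sum_triangle (fun p r => \sum_(q < n) \sum_(k < n - q) s p q * t r k)).
  apply: eq_bigr => p _; rewrite exchange_big /=; apply: eq_bigr => q _.
  rewrite /rect mulr_sumr; apply: eq_bigr => r _; by rewrite mulr_sumr.
rewrite (funext E).
rewrite mulrC -(dsumZ _ gs).
apply: (dsum_cvg (B := A * (8 * B))).
- near=> n => i j; rewrite normrM mulrAC ler_pM//.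
  by rewrite -dsum_trunc; exact: (dsum_le (geo_trunc _ _ gt)).
- by move=> i j; rewrite normrM mulrC mulrAC ler_pM// (dsum_le gt).
- by move=> i j; rewrite mulrC; apply: cvgMr; exact: rect_cvg gt.
Unshelve. all: by end_near. Qed.

(* Lax's weights: [lax * lax <= lax] for the Cauchy product. *)
Definition lax (n : nat) : R := (16 * n.+1%:R ^+ 2)^-1.

Lemma lax_gt0 n : 0 < lax n.
Proof. by rewrite invr_gt0 mulr_gt0// exprn_gt0// ltr0Sn. Qed.

Lemma lax0 : lax 0 = 16^-1.
Proof. by rewrite /lax expr1n mulr1. Qed.

Lemma lax_le n : lax n <= 16^-1.
Proof.
rewrite lef_pV2 ?posrE ?mulr_gt0 ?exprn_gt0 ?ltr0Sn//.
by rewrite ler_peMr// exprn_ege1// ler1n.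
Qed.

Lemma sum_invsqr n : \sum_(m < n.+1) (m.+1%:R ^+ 2)^-1 <= 2 - n.+1%:R^-1 :> R.
Proof.
elim: n => [|n IH]; first by rewrite big_ord1 expr1n invr1; lra.
rewrite big_ord_recr /=; apply: le_trans (lerD IH (lexx _)) _.
have n0 : 0 < n.+1%:R :> R by rewrite ltr0Sn.
rewrite -(natr1 n.+1); set x := n.+1%:R in n0 *.
have -> : (x + 1)^-1 = x^-1 - (x * (x + 1))^-1 by field; lra.
have : ((x + 1) ^+ 2)^-1 <= (x * (x + 1))^-1.
  by rewrite lef_pV2 ?posrE; nra.
move: (_ ^-1) (_ ^-1) (_^-1) => u v w; lra.
Qed.

(** With x = m + 1 and y = n - m + 1, so that x + y - 1 = n + 1, the inequality (x + y - 1)^2 <= 2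
    (x^2 + y^2) splits each product into inverse squares, whose sums stay below 2; the 16 in [lax]
    absorbs the constant. *)
Lemma lax_conv n : \sum_(m < n.+1) lax m * lax (n - m)%N <= lax n.
Proof.
have n0 : 0 < n.+1%:R :> R by rewrite ltr0Sn.
pose g m : R := (m.+1%:R ^+ 2)^-1.
have le m : (m < n.+1)%N ->
    lax m * lax (n - m)%N <= (g m + g (n - m)%N) / (128 * n.+1%:R ^+ 2).
  move=> mn; rewrite /lax /g.
  have x0 : 0 < m.+1%:R :> R by rewrite ltr0Sn.
  have y0 : 0 < (n - m).+1%:R :> R by rewrite ltr0Sn.
  have -> : n.+1%:R = m.+1%:R + (n - m).+1%:R - 1 :> R.
    by rewrite -{1}(@subnKC m n) // -addnS natrD -[m.+1%:R]natr1; ring.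
  set x := m.+1%:R in x0 *; set y := (n - m).+1%:R in y0 *.
  have x1 : 1 <= x by rewrite ler1n.
  have y1 : 1 <= y by rewrite ler1n.
  have p0 : 0 < x + y - 1 by lra.
  have -> : (16 * x ^+ 2)^-1 * (16 * y ^+ 2)^-1 =
     (x + y - 1) ^+ 2 * (256 * x ^+ 2 * y ^+ 2 * (x + y - 1) ^+ 2)^-1.
    by field; rewrite ?gt_eqF //; lra.
  have -> : ((x ^+ 2)^-1 + (y ^+ 2)^-1) / (128 * (x + y - 1) ^+ 2) =
     (2 * (x ^+ 2 + y ^+ 2)) * (256 * x ^+ 2 * y ^+ 2 * (x + y - 1) ^+ 2)^-1.
    by field; rewrite ?gt_eqF //; lra.
  apply: ler_wpM2r; last by have := sqr_ge0 (x - y); nra.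
  by rewrite invr_ge0; repeat (apply: mulr_ge0 || apply: exprn_ge0 || lra).
apply: (@le_trans _ _ (\sum_(m < n.+1) (g m + g (n - m)%N) / (128 * n.+1%:R ^+ 2))).
  by apply: ler_sum => m _; exact: le.
rewrite -mulr_suml big_split /=.
have -> : \sum_(m < n.+1) g (n - m)%N = \sum_(m < n.+1) g m.
  rewrite (reindex_inj rev_ord_inj) /=; apply: eq_bigr => m _.
  by rewrite subSS subKn// -ltnS.
have h := sum_invsqr n; have i0 : 0 < n.+1%:R^-1 :> R by rewrite invr_gt0.
rewrite ler_pdivrMr ?mulr_gt0 ?exprn_gt0//.
rewrite /lax invfM mulrACA mulVf ?mulr1 ?gt_eqF ?exprn_gt0//.
have : \sum_(m < n.+1) g m <= 2 by apply: le_trans h _; rewrite gerBl ltW.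
by move: (\sum_(m < _) _) => S; lra.
Qed.

Definition wt K L i j : R := lax (i + j)%N * ('C(i + j, i)%:R * K ^+ i * L ^+ j).

Lemma wt_ge0 K L i j : 0 <= K -> 0 <= L -> 0 <= wt K L i j.
Proof. by move=> K0 L0; rewrite !mulr_ge0 ?exprn_ge0// ltW// lax_gt0. Qed.

Lemma wt_le K L i j : 0 <= K -> 0 <= L -> wt K L i j <= 16^-1 * (K + L) ^+ (i + j).
Proof.
move=> K0 L0; apply: ler_pM; first by rewrite ltW ?lax_gt0.
- by rewrite !mulr_ge0 ?exprn_ge0.
- exact: lax_le.
have ij : (i < (i + j).+1)%N by lia.
rewrite addrC exprDn (bigD1 (Ordinal ij)) //= [(i + j - i)%N]addKn.
rewrite -[leLHS]addr0 lerD//; first by rewrite -[leRHS]mulr_natl mulrA mulrAC.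
by apply: sumr_ge0 => p _; rewrite mulrn_wge0 ?mulr_ge0 ?exprn_ge0.
Qed.

Lemma sum_from (V : nmodType) (f : nat -> V) m k :
  \sum_(m <= i < m + k) f i = \sum_(i < k) f (m + i)%N.
Proof.
rewrite -{1}(add0n m) big_addn addKn big_mkord.
by apply: eq_bigr => i _; rewrite addnC.
Qed.

Lemma wt_mul K L i j : 0 <= K -> 0 <= L ->
  fmul (wt K L) (wt K L) i j <= wt K L i j.
Proof.
move=> K0 L0; set n := (i + j)%N.
pose G p m : R := lax m * lax (n - m)%N * ('C(m, p) * 'C(n - m, i - p))%N%:R.
have G0 p m : 0 <= G p m by rewrite !mulr_ge0// ltW// lax_gt0.
have -> : fmul (wt K L) (wt K L) i j =
    (\sum_(p < i.+1) \sum_(q < j.+1) G p (p + q)%N) * (K ^+ i * L ^+ j).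
  rewrite mulr_suml; apply: eq_bigr => p _; rewrite mulr_suml.
  apply: eq_bigr => q _; rewrite /wt /G.
  have pi : (p <= i)%N by rewrite -ltnS.
  have qj : (q <= j)%N by rewrite -ltnS.
  have -> : (i - p + (j - q) = n - (p + q))%N by rewrite /n; lia.
  have -> : K ^+ i = K ^+ p * K ^+ (i - p) by rewrite -exprD subnKC.
  have -> : L ^+ j = L ^+ q * L ^+ (j - q) by rewrite -exprD subnKC.
  by rewrite natrM; ring.
have -> : wt K L i j = lax n * 'C(n, i)%:R * (K ^+ i * L ^+ j) by rewrite /wt -/n; ring.
rewrite ler_wpM2r ?mulr_ge0 ?exprn_ge0//.
(* Put m = p + q. For fixed p the window p <= m <= p + j is enlarged to all m <= n, so that
   Vandermonde applies at each m after exchanging the sums. *)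
apply: (@le_trans _ _ (\sum_(p < i.+1) \sum_(m < n.+1) G p m)).
  apply: ler_sum => p _.
  have pi : (p <= i)%N by rewrite -ltnS.
  have h1 : (p <= n.+1)%N by rewrite /n; lia.
  have h2 : (p + j.+1 <= n.+1)%N by rewrite /n; lia.
  rewrite -(big_mkord predT (G p)) (big_cat_nat (leq0n p) h1) /=.
  rewrite (big_cat_nat (leq_addr _ _) h2) /=.
  rewrite addrCA sum_from -[leLHS]addr0.
  by apply: lerD => //; rewrite addr_ge0 ?sumr_ge0.
rewrite exchange_big /=.
apply: (@le_trans _ _ (\sum_(m < n.+1) lax m * lax (n - m)%N * 'C(n, i)%:R)).
  apply: ler_sum => m _; rewrite -mulr_sumr -natr_sum ler_wpM2l//.
    by rewrite mulr_ge0// ltW ?lax_gt0.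
  by rewrite binomial.Vandermonde subnKC// -ltnS.
by rewrite -mulr_suml ler_wpM2r// lax_conv.
Qed.

(* The weights are the coefficients of [sum_n lax n * (K x + L y) ^ n]: by
   Vandermonde's identity they inherit [wt * wt <= wt] from [lax], so that
   [maj] is a Banach algebra norm, and a large ratio [L / K] makes the operator
   [d/dx] followed by integration in [y] small. *)
Definition maj K L A a := forall i j, `|a i j| <= A * wt K L i j.

Lemma maj_ge0 K L A a : maj K L A a -> 0 <= A.
Proof.
move=> /(_ 0 0)%N /(le_trans (normr_ge0 _)); rewrite pmulr_lge0//.
by rewrite /wt bin0 !expr0 !mulr1 lax_gt0.
Qed.

Lemma maj_mul K L A B a b : 0 <= K -> 0 <= L -> maj K L A a -> maj K L B b ->
  maj K L (A * B) (fmul a b).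
Proof.
move=> K0 L0 ma mb i j.
apply: (@le_trans _ _ (A * B * fmul (wt K L) (wt K L) i j)); last first.
  by rewrite ler_wpM2l ?wt_mul// mulr_ge0 ?(maj_ge0 ma) ?(maj_ge0 mb).
rewrite (le_trans (ler_norm_sum _ _ _))// mulr_sumr; apply: ler_sum => p _.
rewrite (le_trans (ler_norm_sum _ _ _))// mulr_sumr; apply: ler_sum => q _.
by rewrite normrM mulrACA ler_pM.
Qed.

Lemma maj_wid K L A B a : 0 <= K -> 0 <= L -> A <= B -> maj K L A a -> maj K L B a.
Proof.
by move=> K0 L0 AB ma i j; rewrite (le_trans (ma i j))// ler_wpM2r// wt_ge0.
Qed.

Lemma maj_add K L A B a b : maj K L A a -> maj K L B b ->
  maj K L (A + B) (fun i j => a i j + b i j).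
Proof. by move=> ma mb i j; rewrite mulrDl (le_trans (ler_normD _ _))// lerD. Qed.

Lemma maj_sub K L A B a b : maj K L A a -> maj K L B b ->
  maj K L (A + B) (fun i j => a i j - b i j).
Proof. by move=> ma mb i j; rewrite mulrDl (le_trans (ler_normB _ _))// lerD. Qed.

Definition fcst (k : R) i j : R := if (i, j) == (0, 0)%N then k else 0.
Definition fvarx i j : R := if (i, j) == (1, 0)%N then 1 else 0.
Definition fvary i j : R := if (i, j) == (0, 1)%N then 1 else 0.

(** The constants 16 here and 64 for the variables are the inverses of [lax 0] and [lax 1]. Larger
    weights shrink the variables but not the constants, so smallness is always asked of deviations
    from a constant term. *)
Lemma maj_fcst K L (k : R) : 0 <= K -> 0 <= L -> maj K L (16 * `|k|) (fcst k).
Proof.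
move=> K0 L0 i j; rewrite /fcst; case: eqP => [[-> ->]|_].
  by rewrite /wt bin0 !expr0 !mulr1 lax0 mulrAC divff ?mul1r.
by rewrite normr0 mulr_ge0 ?wt_ge0// mulr_ge0.
Qed.

Lemma maj_fvarx K L : 0 < K -> 0 <= L -> maj K L (64 / K) fvarx.
Proof.
move=> K0 L0 i j; rewrite /fvarx; case: eqP => [[-> ->]|_].
  rewrite normr1 /wt /lax bin1 !expr0 expr1 mulr1 mul1r le_eqVlt; apply/orP; left.
  by apply/eqP; field; lra.
by rewrite normr0 mulr_ge0 ?wt_ge0// ?divr_ge0// ltW.
Qed.

Lemma maj_fvary K L : 0 <= K -> 0 < L -> maj K L (64 / L) fvary.
Proof.
move=> K0 L0 i j; rewrite /fvary; case: eqP => [[-> ->]|_].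
  rewrite normr1 /wt /lax bin0 !expr0 expr1 mulr1 mul1r le_eqVlt; apply/orP; left.
  by apply/eqP; field; lra.
by rewrite normr0 mulr_ge0 ?wt_ge0// ?divr_ge0// ltW.
Qed.

(** * Evaluation of majorised series *)

Definition ev a h : R := dsum (fun i j => power_term a h (i, j)).

(** Half the radius that [wt_le] guarantees: at such points the terms of a majorised series are
    dominated by a multiple of [2^-1 ^+ (i + j)]. *)
Definition small K L h := forall k, `|h 0 k| * (K + L) <= 2^-1.

Lemma maj_geo K L A a h : 0 <= K -> 0 <= L -> small K L h -> maj K L A a ->
  geo (A / 16) (fun i j => power_term a h (i, j)).
Proof.
move=> K0 L0 sh ma i j; rewrite /power_term /= !normrM !normrX.
have A0 := maj_ge0 ma.
have KL0 : 0 <= K + L by rewrite addr_ge0.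
have := le_trans (ma i j) (ler_wpM2l A0 (wt_le i j K0 L0)).
have hk k n : `|h 0 k| ^+ n * (K + L) ^+ n <= 2^-1 ^+ n.
  by rewrite -exprMn lerXn2r ?sh// nnegrE ?mulr_ge0// invr_ge0.
move=> ha; have hi := hk 0 i; have hj := hk 1 j.
apply: le_trans (_ : A * (16^-1 * (K + L) ^+ (i + j)) * `|h 0 0| ^+ i * `|h 0 1| ^+ j <= _).
  by rewrite ler_wpM2r ?exprn_ge0// ler_wpM2r ?exprn_ge0.
rewrite !exprD.
have -> : A * (16^-1 * ((K + L) ^+ i * (K + L) ^+ j)) * `|h 0 0| ^+ i * `|h 0 1| ^+ j =
  A / 16 * ((`|h 0 0| ^+ i * (K + L) ^+ i) * (`|h 0 1| ^+ j * (K + L) ^+ j)) by ring.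
by rewrite ler_wpM2l ?divr_ge0// ler_pM// mulr_ge0 ?exprn_ge0.
Qed.

Lemma ev_le K L A a h : 0 <= K -> 0 <= L -> small K L h -> maj K L A a ->
  `|ev a h| <= A.
Proof.
move=> K0 L0 sh ma; have A0 := maj_ge0 ma.
by apply: le_trans (dsum_le (maj_geo K0 L0 sh ma)) _; lra.
Qed.

Lemma ev_mul K L A B a b h : 0 <= K -> 0 <= L -> small K L h ->
  maj K L A a -> maj K L B b -> ev (fmul a b) h = ev a h * ev b h.
Proof.
move=> K0 L0 sh ma mb.
rewrite -(dsum_mul (maj_geo K0 L0 sh ma) (maj_geo K0 L0 sh mb)).
congr dsum; apply/funext => i; apply/funext => j; rewrite /power_term /fmul /=.
rewrite !mulr_suml; apply: eq_bigr => p _.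
rewrite !mulr_suml; apply: eq_bigr => q _.
have pi : (p <= i)%N by rewrite -ltnS.
have qj : (q <= j)%N by rewrite -ltnS.
have -> : h 0 0 ^+ i = h 0 0 ^+ p * h 0 0 ^+ (i - p) by rewrite -exprD subnKC.
have -> : h 0 1 ^+ j = h 0 1 ^+ q * h 0 1 ^+ (j - q) by rewrite -exprD subnKC.
by ring.
Qed.

Lemma ev_add K L A B a b h : 0 <= K -> 0 <= L -> small K L h ->
  maj K L A a -> maj K L B b -> ev (fun i j => a i j + b i j) h = ev a h + ev b h.
Proof.
move=> K0 L0 sh ma mb.
rewrite -(dsumD (maj_geo K0 L0 sh ma) (maj_geo K0 L0 sh mb)).
by congr dsum; apply/funext => i; apply/funext => j; rewrite /power_term /= !mulrDl.
Qed.

Lemma ev_scale K L A (k : R) a h : 0 <= K -> 0 <= L -> small K L h ->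
  maj K L A a -> ev (fun i j => k * a i j) h = k * ev a h.
Proof.
move=> K0 L0 sh ma.
rewrite -(dsumZ k (maj_geo K0 L0 sh ma)).
by congr dsum; apply/funext => i; apply/funext => j; rewrite /power_term /= !mulrA.
Qed.

Lemma ev_fcst (k : R) h : ev (fcst k) h = k.
Proof.
rewrite /ev (@dsum_fin _ _ 1); last first.
  by case=> [|i] [|j] //= _; rewrite /power_term /fcst /= !mul0r.
by rewrite /sqsum !big_ord1 /power_term /= !expr0 !mulr1.
Qed.

Lemma ev_fvarx h : ev fvarx h = h 0 0.
Proof.
rewrite /ev (@dsum_fin _ _ 2); last first.
  by case=> [|[|i]] [|j] //= _; rewrite /power_term /fvarx /= !mul0r.
by rewrite /sqsum !big_ord_recl !big_ord0 /power_term /fvarx /= !mul0r !expr0 expr1 !mulr1 !mul1r !addr0 add0r.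
Qed.

Lemma ev_fvary h : ev fvary h = h 0 1.
Proof.
rewrite /ev (@dsum_fin _ _ 2); last first.
  by case=> [|i] [|[|j]] //= _; rewrite /power_term /fvary /= !mul0r.
by rewrite /sqsum !big_ord_recl !big_ord0 /power_term /fvary /= !mul0r !expr0 expr1 !mul1r !addr0 add0r.
Qed.

End FormalSeries.

(** * Composition of series *)

Section Composition.
Context {R : realType}.
Implicit Types (a b f : nat -> nat -> R) (A B C S K L d : R) (h : 'rV[R]_2).
Implicit Types (u v : 'I_2 -> nat -> nat -> R).

Lemma ord2P (P : 'I_2 -> Prop) : P 0 -> P 1 -> forall k, P k.
Proof.
move=> P0 P1 [[|[|k]] hk] //; first by rewrite (_ : Ordinal hk = 0)//; apply: val_inj.
by rewrite (_ : Ordinal hk = 1)//; apply: val_inj.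
Qed.

Definition fmono k l u := iter k (fmul (u 0)) (iter l (fmul (u 1)) (fcst 1)).

Lemma maj_mono K L d u k l : 0 <= K -> 0 <= L -> (forall i, maj K L d (u i)) ->
  maj K L (16 * d ^+ (k + l)) (fmono k l u).
Proof.
move=> K0 L0 mu; elim: k => [|k IH].
  elim: l => [|l IH] /=.
    by have := maj_fcst 1 K0 L0; rewrite normr1 expr0.
  by rewrite add0n exprS mulrCA; apply: maj_mul.
by rewrite addSn exprS mulrCA; apply: maj_mul.
Qed.

Lemma ev_mono K L d u k l h : 0 <= K -> 0 <= L -> small K L h ->
  (forall i, maj K L d (u i)) ->
  ev (fmono k l u) h = ev (u 0) h ^+ k * ev (u 1) h ^+ l.
Proof.
move=> K0 L0 sh mu; elim: k => [|k IH].
  rewrite expr0 mul1r; elim: l => [|l IH] /=; first by rewrite ev_fcst.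
  rewrite (ev_mul K0 L0 sh (mu 1) (maj_mono 0 l K0 L0 mu)).
  by rewrite IH exprS.
rewrite [fmono _ _ _]/= (ev_mul K0 L0 sh (mu 0) (maj_mono k l K0 L0 mu)).
by rewrite IH exprS mulrA.
Qed.

(** Each coefficient is an infinite sum of reals, so [u] may have a nonzero constant term;
    convergence comes from S d <= 1/2, where [d] majorises [u]. *)
Definition fcomp f u i j := dsum (fun k l => f k l * fmono k l u i j).

Definition bnd C S f := forall k l, `|f k l| <= C * S ^+ (k + l).

Definition vanish m f := forall k l, (k + l < m)%N -> f k l = 0.

Lemma bnd_ge0 C S f : bnd C S f -> 0 <= C.
Proof. by move=> /(_ 0 0)%N; rewrite mulr1; apply: le_trans. Qed.

(** Write (S d)^(k+l) as (2 S d)^(k+l) 2^-(k+l). The second factor gives summability; the first is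
    at most (2 S d)^m when k + l >= m. This gain is used with m = 1 in [lifts_comp] and with m = 2
    in [formal_inverse]. *)
Lemma comp_geo m C S K L d f u i j : 0 <= K -> 0 <= L -> 0 <= S -> S * d <= 2^-1 ->
  bnd C S f -> vanish m f -> (forall i, maj K L d (u i)) ->
  geo (C * 16 * (2 * (S * d)) ^+ m * wt K L i j) (fun k l => f k l * fmono k l u i j).
Proof.
move=> K0 L0 S0 Sd bf of_ mu k l.
have d0 := maj_ge0 (mu 0); have C0 := bnd_ge0 bf.
have w0 := wt_ge0 i j K0 L0.
set e := 2 * (S * d).
have e0 : 0 <= e by rewrite !mulr_ge0.
have e1 : e <= 1 by rewrite /e; lra.
have D0 : 0 <= C * 16 * wt K L i j by apply: mulr_ge0 => //; apply: mulr_ge0.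
have -> : C * 16 * e ^+ m * wt K L i j * 2^-1 ^+ (k + l) =
  C * 16 * wt K L i j * (e ^+ m * 2^-1 ^+ (k + l)) by ring.
have [klm|mkl] := ltnP (k + l) m.
  by rewrite of_// mul0r normr0 mulr_ge0// mulr_ge0 ?exprn_ge0// invr_ge0.
rewrite normrM (le_trans (ler_pM _ _ (bf k l) (maj_mono k l K0 L0 mu i j)))//.
have -> : C * S ^+ (k + l) * (16 * d ^+ (k + l) * wt K L i j) =
  C * 16 * wt K L i j * (e ^+ (k + l) * 2^-1 ^+ (k + l)).
  rewrite -exprMn (_ : e * 2^-1 = S * d); last by rewrite /e; lra.
  by rewrite exprMn; ring.
rewrite ler_wpM2l// ler_wpM2r ?exprn_ge0 ?invr_ge0//.
by rewrite -(subnKC mkl) exprD ler_piMr ?exprn_ge0 ?exprn_ile1.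
Qed.

Lemma maj_comp m C S K L d f u : 0 <= K -> 0 <= L -> 0 <= S -> S * d <= 2^-1 ->
  bnd C S f -> vanish m f -> (forall i, maj K L d (u i)) ->
  maj K L (128 * C * (2 * (S * d)) ^+ m) (fcomp f u).
Proof.
move=> K0 L0 S0 Sd bf of_ mu i j.
apply: le_trans (dsum_le (comp_geo i j K0 L0 S0 Sd bf of_ mu)) _.
by rewrite le_eqVlt; apply/orP; left; apply/eqP; ring.
Qed.

Lemma order0 f : vanish 0 f. Proof. by []. Qed.

Lemma sqsum_le B (s : nat -> nat -> R) n : geo B s -> `|sqsum s n| <= 8 * B.
Proof.
move=> gs; have := geo_sqsum_le gs (leq0n n).
by rewrite {2}/sqsum big_ord0 subr0 expr0 mulr1.
Qed.

Lemma ev_sum K L h (F : nat -> nat -> nat -> R) (D : nat -> R) n :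
  0 <= K -> 0 <= L -> small K L h -> (forall k, maj K L (D k) (F k)) ->
  maj K L (\sum_(k < n) D k) (fun i j => \sum_(k < n) F k i j) /\
  ev (fun i j => \sum_(k < n) F k i j) h = \sum_(k < n) ev (F k) h.
Proof.
move=> K0 L0 sh mF.
have c0 : (fun i j => \sum_(k < 0) F k i j) = fcst 0.
  apply/funext => i; apply/funext => j; rewrite big_ord0 /fcst; by case: ifP.
elim: n => [|n [IH1 IH2]].
  rewrite c0 !big_ord0 ev_fcst; split => // i j.
  by rewrite /fcst if_same normr0 mul0r.
have -> : (fun i j => \sum_(k < n.+1) F k i j) =
   (fun i j => \sum_(k < n) F k i j + F n i j).
  by apply/funext => i; apply/funext => j; rewrite big_ord_recr.
rewrite !big_ord_recr /= (ev_add K0 L0 sh IH1 (mF n)) IH2; split => //.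
exact: maj_add.
Qed.

Lemma maj_scale K L A (k : R) a : maj K L A a ->
  maj K L (`|k| * A) (fun i j => k * a i j).
Proof. by move=> ma i j; rewrite normrM -mulrA ler_wpM2l. Qed.

(** Partial sums of the outer series are finite combinations of the [fmono k l u], hence evaluated
    by the algebra rules; they share the majorant [128 * C] and converge coefficientwise, so
    dominated convergence gives the limit. *)
Lemma ev_comp C S K L d f u h : 0 <= K -> 0 <= L -> 0 <= S -> S * d <= 2^-1 ->
  small K L h -> bnd C S f -> (forall i, maj K L d (u i)) ->
  sqsum (fun k l => power_term f (\row_i ev (u i) h) (k, l)) @ \oo --> ev (fcomp f u) h.
Proof.
move=> K0 L0 S0 Sd sh bf mu.
have G i j := comp_geo i j K0 L0 S0 Sd bf (@order0 f) mu.
pose c n i j := sqsum (fun k l => f k l * fmono k l u i j) n.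
have mc n : maj K L (128 * C) (c n).
  move=> i j; apply: le_trans (sqsum_le n (G i j)) _.
  by rewrite le_eqVlt; apply/orP; left; apply/eqP; rewrite expr0; ring.
have E n : sqsum (fun k l => power_term f (\row_i ev (u i) h) (k, l)) n = ev (c n) h.
  have mk k l := maj_scale (f k l) (maj_mono k l K0 L0 mu).
  have H k := ev_sum n K0 L0 sh (mk k).
  rewrite [RHS](ev_sum n K0 L0 sh (fun k => (H k).1)).2.
  apply: eq_bigr => k _; rewrite (H k).2; apply: eq_bigr => l _.
  rewrite (ev_scale _ K0 L0 sh (maj_mono k l K0 L0 mu)) (ev_mono _ _ K0 L0 sh mu).
  by rewrite /power_term !mxE /= mulrA.
rewrite (funext E).
apply: (dsum_cvg (B := 128 * C / 16)).
- by near=> n; exact: maj_geo (mc n).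
- have := maj_comp K0 L0 S0 Sd bf (@order0 f) mu; rewrite expr0 mulr1.
  exact: maj_geo.
- move=> i j; apply: cvgMl; apply: cvgMl; exact: geo_cvg (G i j).
Unshelve. all: by end_near. Qed.

(** Monotonicity ensures that a coefficient of a Cauchy product involves only factors of no larger
    grade. The instances are the total degree, for inverse functions, and the x_2-degree, for the
    evolution equation. *)
Definition grading (gr : nat -> nat -> nat) :=
  forall p q i j, (p <= i)%N -> (q <= j)%N -> (gr p q <= gr i j)%N.

Definition agree (gr : nat -> nat -> nat) n a b :=
  forall i j, (gr i j < n)%N -> a i j = b i j.

Lemma agree_mul gr n a a' b b' : grading gr -> agree gr n a a' -> agree gr n b b' ->
  agree gr n (fmul a b) (fmul a' b').
Proof.
move=> gd aa bb i j dij; apply: eq_bigr => p _; apply: eq_bigr => q _.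
rewrite aa ?bb//; apply: leq_ltn_trans dij; apply: gd; rewrite ?leq_subr// -ltnS//.
Qed.

Lemma agree_mono gr n k l u v : grading gr -> (forall i, agree gr n (u i) (v i)) ->
  agree gr n (fmono k l u) (fmono k l v).
Proof.
move=> gd uv; elim: k => [|k IH]; last exact: agree_mul.
by elim: l => [//|l IH]; exact: agree_mul.
Qed.

Lemma agree_comp gr n f u v : grading gr -> (forall i, agree gr n (u i) (v i)) ->
  agree gr n (fcomp f u) (fcomp f v).
Proof.
move=> gd uv i j dij; congr dsum; apply/funext => k; apply/funext => l.
by rewrite (agree_mono k l gd uv).
Qed.

Lemma comp_split C S K L d f g u i j : 0 <= K -> 0 <= L -> 0 <= S -> S * d <= 2^-1 ->
  bnd C S f -> bnd C S g -> (forall i, maj K L d (u i)) ->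
  fcomp (fun k l => f k l + g k l) u i j = fcomp f u i j + fcomp g u i j.
Proof.
move=> K0 L0 S0 Sd bf bg mu.
rewrite -(dsumD (comp_geo i j K0 L0 S0 Sd bf (@order0 f) mu)
  (comp_geo i j K0 L0 S0 Sd bg (@order0 g) mu)).
by congr dsum; apply/funext => k; apply/funext => l; rewrite mulrDl.
Qed.

Lemma comp_cst (c : R) u : fcomp (fcst c) u = fcst c.
Proof.
apply/funext => i; apply/funext => j; rewrite /fcomp (@dsum_fin _ _ 1).
  by rewrite /sqsum !big_ord1 /fmono /fcst /=; case: ifP; rewrite ?mulr1 ?mulr0.
by case=> [|k] [|l] //= _; rewrite /fcst /= mul0r.
Qed.

End Composition.

(** * Analytic functions acting on formal series *)

Section Lifts.
Context {R : realType}.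
Implicit Types (a b : nat -> nat -> R) (A B C S K L e : R) (p h x y : 'rV[R]_2).
Implicit Types (f : 'rV[R]_2 -> R).

Lemma geo_summable B (s : nat -> nat -> R) : geo B s ->
  summable [set: nat * nat] (fun k => (s k.1 k.2)%:E).
Proof.
move=> gs; apply: (@le_lt_trans _ _ (4 * B)%:E); last exact: ltry.
apply: ge_ereal_sup => /= _ [X [finX _] <-].
pose n := \max_(k <- finmap.enum_fset (fset_set X)) (k.1 + k.2).+1.
have Xn k : X k -> (k.1 < n)%N && (k.2 < n)%N.
  move=> Xk; have : ((k.1 + k.2).+1 <= n)%N.
    apply: (@leq_bigmax_seq _ _ xpredT (fun k => (k.1 + k.2).+1) k) => //.
    by rewrite in_fset_set ?inE.
  lia.
pose t i j : R := B * 2^-1 ^+ (i + j).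
apply: (@le_trans _ _ (sqsum t n)%:E); last first.
  rewrite lee_fin sqsum_half mulrC ler_wpM2r ?(geo_ge0 gs)//.
  by have /andP[a0 a1] := half_itv (R := R) n; nra.
have -> : (sqsum t n)%:E = (\sum_(k \in `I_n `*` `I_n) (t k.1 k.2)%:E)%E.
  rewrite -(@pair_fsbig _ _ _ _ _ _ _ (fun i j => (t i j)%:E))// -fsbig_ord -sumEFin.
  by apply: eq_bigr => i _; rewrite -fsbig_ord -sumEFin.
have t0 k : (0 <= (t k.1 k.2)%:E)%E.
  by rewrite lee_fin mulr_ge0 ?(geo_ge0 gs)// exprn_ge0 ?invr_ge0.
apply: (@le_trans _ _ (\sum_(k \in X) (t k.1 k.2)%:E)%E).
  by apply: lee_fsum => // k _; rewrite lee_fin gs.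
apply: lee_fsum_nneg_subset => //; first by apply: finite_setX; exact: finite_II.
by move=> k; rewrite !inE => /Xn /andP[].
Qed.

Lemma near_coord p e : 0 < e -> \forall x \near p, forall k, `|(x - p) 0 k| <= e.
Proof.
move=> e0; near=> x => k; rewrite !mxE distrC.
have : ball p e x by near: x; exact: nbhsx_ballx.
by case=> _ /(_ 0 k) /ltW.
Unshelve. all: by end_near. Qed.

Lemma near_coordP p (P : 'rV[R]_2 -> Prop) : (\forall x \near p, P x) ->
  exists2 e : R, 0 < e & forall y, (forall k, `|y 0 k| <= e) -> P (p + y).
Proof.
move=> /nbhs_ballP[e /= e0 he]; exists (e / 2); first by rewrite divr_gt0.
move=> y ye; apply: he; split => // i k; rewrite (ord1 i) /ball /= !mxE opprD addNKr normrN.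
by apply: le_lt_trans (ye k) _; lra.
Qed.

Lemma near_small p K L : 0 < K -> 0 < L -> \forall x \near p, small K L (x - p).
Proof.
move=> K0 L0; near=> x => k.
rewrite -ler_pdivlMr ?addr_gt0//; move: k.
by near: x; apply: near_coord; rewrite divr_gt0 ?invr_gt0 ?addr_gt0.
Unshelve. all: by end_near. Qed.

Definition has_series f p a := \forall x \near p,
  summable [set: nat * nat] (fun k => (power_term a (x - p) k)%:E) /\
  sqsum (fun i j => power_term a (x - p) (i, j)) @ \oo --> f x.

Lemma maj_series K L A f p a : 0 < K -> 0 < L -> maj K L A a ->
  (\forall x \near p, f x = ev a (x - p)) -> has_series f p a.
Proof.
move=> K0 L0 ma fa; near=> x.
have g : geo (A / 16) (fun i j => power_term a (x - p) (i, j)).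
  apply: maj_geo ma; rewrite ?ltW//; near: x; exact: near_small.
split; first by have := geo_summable g; congr summable; apply/funext => -[].
rewrite (_ : f x = ev a (x - p)); first exact: geo_cvg g.
by near: x.
Unshelve. all: by end_near. Qed.

(** Cauchy's estimates: at the corner point (e, e) each term is bounded by the sum of all absolute
    values, which gives [bnd] with S = 1 / e. *)
Lemma series_nbhs f p a : has_series f p a ->
  exists2 e : R, 0 < e &
   exists C S, [/\ 0 < S, bnd C S a &
     forall y, (forall k, `|y 0 k| <= e) ->
       sqsum (fun i j => power_term a y (i, j)) @ \oo --> f (p + y)].
Proof.
move=> /near_coordP[e e0 he]; exists e => //.
have : forall k, `|(const_mx e : 'rV[R]_2) 0 k| <= e by move=> k; rewrite mxE gtr0_norm.
move=> /he[]; rewrite addrC addKr => + _.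
set s := (fun k => _) => sm.
have fs : (\esum_(k in [set: nat * nat]) `|s k|)%E \is a fin_num by rewrite -summableE.
exists (fine (\esum_(k in [set: nat * nat]) `|s k|)%E), e^-1; split; first by rewrite invr_gt0.
  move=> i j.
  rewrite exprVn ler_pdivlMr ?exprn_gt0// -lee_fin fineK//.
  apply: esum_ge; exists [set (i, j)]; first by split.
  rewrite fsbig_set1 /s /power_term /= !mxE; change ((`|a i j| * e ^+ (i + j))%:E <= (`|a i j * e ^+ i * e ^+ j|)%:E)%E; rewrite lee_fin !normrM !normrX (gtr0_norm e0) exprD.
  by rewrite mulrA.
by move=> y /he[_]; have -> : p + y - p = y by rewrite addrC addKr.
Qed.

Lemma ev_at0 a : ev a 0 = a 0%N 0%N.
Proof.
rewrite /ev (@dsum_fin _ _ 1).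
  by rewrite /sqsum !big_ord1 /power_term /= !expr0 !mulr1.
by case=> [|i] [|j] //= _; rewrite /power_term /= !mxE !exprS !(mul0r, mulr0).
Qed.

Lemma series_at f p a : has_series f p a -> f p = a 0%N 0%N.
Proof.
move=> /series_nbhs[e e0 [C [S [S0 ba /(_ 0)]]]].
rewrite addr0 -ev_at0 => H; apply/esym/cvg_dsum; apply: H => k.
by rewrite mxE normr0 ltW.
Qed.

(* [t] lifts near [z] to an operator [T] on families of formal series.  The
   smallness [d] must not depend on the weights [K] and [L]: this is what lets
   the fixed point arguments choose the weights last.  Agreement up to degree
   [n] in any grading is preserved, so a formal iteration stabilises
   coefficientwise. *)
Definition lifts (I : Type) (t : (I -> R) -> R) (z : I -> R) :=
  exists T : (I -> nat -> nat -> R) -> nat -> nat -> R,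
    (forall gr n u v, grading gr -> (forall i, agree gr n (u i) (v i)) ->
       agree gr n (T u) (T v)) /\
    forall e, 0 < e -> exists2 d, 0 < d &
      forall K L u, 0 < K -> 0 < L -> (forall i, maj K L d (u i)) ->
        maj K L e (fun i j => T u i j - fcst (t z) i j) /\
        forall h, small K L h -> ev (T u) h = t (fun i => z i + ev (u i) h).

Lemma maj_from_sub K L A B a b : maj K L A (fun i j => a i j - b i j) ->
  maj K L B b -> maj K L (A + B) a.
Proof.
move=> ma mb i j; have := maj_add ma mb i j; by rewrite subrK.
Qed.

Lemma ev_sub K L A B a b h : 0 <= K -> 0 <= L -> small K L h ->
  maj K L A a -> maj K L B b -> ev (fun i j => a i j - b i j) h = ev a h - ev b h.
Proof.
move=> K0 L0 sh ma mb.
have E : a = fun i j => (a i j - b i j) + b i j.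
  by apply/funext => i; apply/funext => j; rewrite subrK.
by rewrite [in RHS]E (ev_add K0 L0 sh (maj_sub ma mb) mb) addrK.
Qed.

Lemma lifts_cst (I : Type) (c : R) (z : I -> R) : lifts (fun=> c) z.
Proof.
exists (fun=> fcst c); split=> // e e0; exists 1 => // K L u K0 L0 mu; split.
  by move=> i j; rewrite subrr normr0 mulr_ge0 ?wt_ge0 ?ltW.
by move=> h _; rewrite ev_fcst.
Qed.

Lemma lifts_proj (I : Type) (i : I) (z : I -> R) : lifts (fun w => w i) z.
Proof.
exists (fun u m n => fcst (z i) m n + u i m n); split.
  by move=> gr n u v _ uv p q pq; rewrite uv.
move=> e e0; exists e => // K L u K0 L0 mu; split.
  by move=> p q; rewrite addrAC subrr add0r; exact: mu.
move=> h sh.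
by rewrite (ev_add (ltW K0) (ltW L0) sh (maj_fcst _ (ltW K0) (ltW L0)) (mu i)) ev_fcst.
Qed.

Lemma bnd_drop C S a : bnd C S a ->
  bnd C S (fun i j => if (i + j == 0)%N then 0 else a i j).
Proof.
move=> ba i j; case: ifP => // _; rewrite normr0.
exact: le_trans (normr_ge0 _) (ba i j).
Qed.

Lemma bnd_cst0 C S a : 0 < S -> bnd C S a -> bnd C S (fcst (a 0%N 0%N)).
Proof.
move=> S0 ba i j; rewrite /fcst; case: eqP => [[-> ->]|_]; first exact: ba.
by rewrite normr0 mulr_ge0 ?exprn_ge0 ?(bnd_ge0 ba) ?ltW.
Qed.

Lemma lifts_comp (I : Type) f (t : 'I_2 -> (I -> R) -> R) (z : I -> R) :
  analytic_at f (\row_k t k z) -> (forall k, lifts (t k) z) ->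
  lifts (fun w => f (\row_k t k w)) z.
Proof.
move=> [a fa] /choice[T HT].
pose V u k i j := T k u i j - fcst (t k z) i j.
exists (fun u => fcomp a (V u)); split.
  move=> gr n u v gu uv; apply: agree_comp => // k i j ij; rewrite /V.
  by rewrite ((HT k).1 gr n u v gu uv i j ij).
move=> e e0; rewrite (series_at fa).
have [r r0 [C [S [S0 ba ra]]]] := series_nbhs fa.
have C0 := bnd_ge0 ba.
pose D := 128 * C * (2 * S) + 1.
have D0 : 0 < D by apply: ltr_wpDl => //; rewrite !mulr_ge0// ltW.
(* The bound [r] keeps the inner values where the series represents [f], (2 S)^-1 makes the
   composition converge, and e / D brings the order 1 remainder 128 C (2 S d) below [e]. The 1 in
   [D] keeps it positive when C = 0. *)
pose d := Num.min (Num.min r (2 * S)^-1) (e / D).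
have d0 : 0 < d by rewrite !lt_min r0 invr_gt0 divr_gt0// mulr_gt0.
have Sd : S * d <= 2^-1.
  have : d <= (2 * S)^-1 by rewrite !ge_min lexx orbT.
  by rewrite -div1r ler_pdivlMr ?mulr_gt0// => h; lra.
have dr : d <= r by rewrite !ge_min lexx.
have dD : 128 * C * (2 * (S * d)) <= e.
  have : d <= e / D by rewrite !ge_min lexx orbT.
  rewrite ler_pdivlMr// /D; nra.
have /choice[d1 Hd1] : forall k, exists d1, 0 < d1 /\
    forall K L u, 0 < K -> 0 < L -> (forall i, maj K L d1 (u i)) ->
        maj K L d (V u k) /\
        forall h, small K L h -> ev (T k u) h = t k (fun i => z i + ev (u i) h).
  by move=> k; have [d1 d10 H1] := (HT k).2 d d0; exists d1; split.
exists (Num.min (d1 0) (d1 1)).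
  by rewrite lt_min (Hd1 0).1 (Hd1 1).1.
move=> K L u K0 L0 mu; have K1 := ltW K0; have L1 := ltW L0.
have S1 := ltW S0.
have {}Hd1 k : maj K L d (V u k) /\
    forall h, small K L h -> ev (T k u) h = t k (fun i => z i + ev (u i) h).
  apply: (Hd1 k).2 => // i; apply: maj_wid (mu i) => //.
  by move: k; apply: ord2P; rewrite ge_min lexx ?orbT.
have mV k := (Hd1 k).1.
split.
  pose a' i j := if (i + j == 0)%N then 0 else a i j.
  have Ea : a = fun i j => a' i j + fcst (a 0%N 0%N) i j.
    apply/funext => i; apply/funext => j; rewrite /a' /fcst xpair_eqE addn_eq0.
    by case: ifP => [/andP[/eqP-> /eqP->]|_]; rewrite ?add0r ?addr0.
  have E i j : fcomp a (V u) i j - fcst (a 0%N 0%N) i j = fcomp a' (V u) i j.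
    rewrite {1}Ea (comp_split i j K1 L1 S1 Sd (bnd_drop ba) (bnd_cst0 S0 ba) mV).
    by rewrite comp_cst addrK.
  move=> i j; rewrite E.
  have o1 : vanish 1 a' by move=> k l; rewrite ltnS leqn0 /a' => ->.
  have := maj_comp K1 L1 S1 Sd (bnd_drop ba) o1 mV; rewrite expr1 => H.
  exact: maj_wid H i j.
move=> h sh; have ec := ev_comp K1 L1 S1 Sd sh ba mV.
have re k : `|(\row_i ev (V u i) h) 0 k| <= r.
  by rewrite mxE (le_trans (ev_le K1 L1 sh (mV k))).
rewrite -(cvg_lim _ ec)// (cvg_lim _ (ra _ re))//; congr f; apply/rowP => k.
rewrite !mxE -(Hd1 k).2// (ev_sub K1 L1 sh (maj_from_sub (mV k) (maj_fcst (t k z) K1 L1)) (maj_fcst (t k z) K1 L1)).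
by rewrite ev_fcst addrC subrK.
Qed.

End Lifts.

(** * Closure properties of analytic functions *)

Section Analytic.
Context {R : realType}.
Implicit Types (a b : nat -> nat -> R) (A B C S K L e : R) (p h x y : 'rV[R]_2).
Implicit Types (f g : 'rV[R]_2 -> R).

Lemma sqr_le_exp4 n : (n.+1 ^ 2 <= 4 ^ n)%N.
Proof.
elim: n => [//|n IH]; rewrite [(4 ^ n.+1)%N]expnS; apply: (@leq_trans (4 * n.+1 ^ 2)%N); last exact: leq_mul.
by rewrite !expnS !expn0; nia.
Qed.

Lemma wt_ge K i j : 0 <= K -> 16^-1 * (K / 4) ^+ (i + j) <= wt K K i j.
Proof.
move=> K0; rewrite /wt -mulrA -exprD exprMn; set n := (i + j)%N.
have Kn : 0 <= K ^+ n by rewrite exprn_ge0.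
apply: (@le_trans _ _ (lax n * K ^+ n)).
  rewrite mulrC -mulrA mulrC ler_wpM2r// /lax exprVn -invfM.
  rewrite lef_pV2 ?posrE ?mulr_gt0 ?exprn_gt0 ?ltr0Sn// mulrC ler_wpM2r//.
  by rewrite -!natrX ler_nat sqr_le_exp4.
rewrite ler_wpM2l ?(ltW (lax_gt0 _))// ler_peMl// ler1n bin_gt0 leq_addr//.
Qed.

Lemma bnd_maj C S a d : 0 < S -> 0 < d -> bnd C S a -> vanish 1 a ->
  \forall K \near +oo, maj K K d a.
Proof.
move=> S0 d0 ba oa; have C0 := bnd_ge0 ba.
(* Once K >= 4 S m, [wt_ge] bounds the weight below by (S m)^(i+j) / 16. As i + j >= 1, this is at
   least S^(i+j) m / 16, and m >= 16 C / d. *)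
pose m := 1 + 16 * C / d.
have m1 : 1 <= m by rewrite lerDl !mulr_ge0// invr_ge0 ltW.
near=> K => i j.
have KS : 4 * S * m <= K by near: K; apply: nbhs_pinfty_ge; rewrite num_real.
have K0 : 0 <= K by apply: le_trans KS; rewrite !mulr_ge0 ?ltW//; lra.
have [ij|ij] := ltnP (i + j) 1.
  by rewrite oa// normr0 mulr_ge0 ?wt_ge0// ltW.
apply: le_trans (ba i j) _.
apply: le_trans (ler_wpM2l (ltW d0) (wt_ge i j K0)).
have : (S * m) ^+ (i + j) <= (K / 4) ^+ (i + j).
  by rewrite lerXn2r ?nnegrE ?divr_ge0 ?mulr_ge0//; lra.
have mm : m <= m ^+ (i + j) by rewrite -{1}(expr1 m) ler_weXn2l.
rewrite exprMn => h.
have Sn : 0 <= S ^+ (i + j) by rewrite exprn_ge0// ltW.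
have : S ^+ (i + j) * m <= (K / 4) ^+ (i + j) by apply: le_trans h; rewrite ler_wpM2l.
have dm : C * 16 <= d * m.
  have -> : d * m = d + 16 * C by rewrite /m; field; rewrite gt_eqF.
  by lra.
move=> h2; have := ler_wpM2l Sn dm; have := ler_wpM2l (ltW d0) h2.
by rewrite mulrCA; lra.
Unshelve. all: by end_near. Qed.

Lemma series_bnd f p a : has_series f p a -> exists C S, 0 < S /\ bnd C S a.
Proof. by move=> /series_nbhs[e _ [C [S [? ? _]]]]; exists C, S. Qed.

Lemma drop_order1 a : vanish 1 (fun i j => a i j - fcst (a 0%N 0%N) i j).
Proof. by case=> [|i] [|j]// _; rewrite /fcst /= subrr. Qed.

Lemma bnd_sub0 C S a : 0 < S -> bnd C S a ->
  bnd C S (fun i j => a i j - fcst (a 0%N 0%N) i j).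
Proof.
move=> S0 ba i j; rewrite /fcst xpair_eqE; case: ifP => [/andP[/eqP-> /eqP->]|_].
  by rewrite subrr normr0 mulr_ge0 ?(bnd_ge0 ba)// exprn_ge0.
by rewrite subr0.
Qed.

Lemma series_small f p a d : 0 < d -> has_series f p a ->
  \forall K \near +oo, maj K K d (fun i j => a i j - fcst (a 0%N 0%N) i j).
Proof.
move=> d0 /series_bnd[C [S [S0 ba]]].
exact: bnd_maj S0 d0 (bnd_sub0 S0 ba) (@drop_order1 a).
Qed.

Lemma series_maj f p a : has_series f p a ->
  \forall K \near +oo, maj K K (1 + 16 * `|a 0%N 0%N|) a.
Proof.
move=> /series_small => /(_ 1 ltr01) H; near=> K.
have K0 : 0 < K by near: K; apply: nbhs_pinfty_gt; rewrite num_real.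
apply: (maj_from_sub (b := fcst (a 0%N 0%N))); last by apply: maj_fcst; exact: ltW.
by near: K.
Unshelve. all: by end_near. Qed.

Lemma series_ev f p a : has_series f p a -> \forall x \near p, f x = ev a (x - p).
Proof.
by apply: filterS => x [_ /cvg_dsum].
Qed.

Lemma near_pinfty_ex (P : R -> Prop) : (\forall K \near +oo, P K) ->
  exists2 K, 0 < K & P K.
Proof.
move=> H; have : \forall K \near +oo, 0 < K /\ P K.
  by near=> K; split; near: K => //; apply: nbhs_pinfty_gt; rewrite num_real.
by move=> /filter_ex[K []]; exists K.
Unshelve. all: by end_near. Qed.

Lemma has_series_cst (c : R) p : has_series (fun=> c) p (fcst c).
Proof.
apply: (maj_series ltr01 ltr01 (maj_fcst c ler01 ler01)).
by near=> x; rewrite ev_fcst.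
Unshelve. all: by end_near. Qed.

Definition fvar (k : 'I_2) : nat -> nat -> R := if k == 0 then fvarx else fvary.

Lemma ev_var k h : ev (fvar k) h = h 0 k.
Proof. by move: k; apply: ord2P; [exact: ev_fvarx|exact: ev_fvary]. Qed.

Lemma maj_var K k : 0 < K -> maj K K (64 / K) (fvar k).
Proof.
move=> K0; move: k; apply: ord2P; first by apply: maj_fvarx => //; exact: ltW.
by apply: maj_fvary => //; exact: ltW.
Qed.

Lemma has_series_coord k p :
  has_series (fun x => x 0 k) p (fun i j => fcst (p 0 k) i j + fvar k i j).
Proof.
have mc := maj_fcst (p 0 k) ler01 ler01; have mv := maj_var k ltr01.
apply: (maj_series ltr01 ltr01 (maj_add mc mv)).
near=> x; have sx : small 1 1 (x - p) by near: x; exact: near_small.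
by rewrite (ev_add ler01 ler01 sx mc mv) ev_fcst ev_var !mxE; lra.
Unshelve. all: by end_near. Qed.

Lemma has_series2 f g p a b (F : R -> R -> R) c :
  has_series f p a -> has_series g p b ->
  (forall K A B, 0 < K -> maj K K A a -> maj K K B b ->
    exists2 D, maj K K D c & forall h, small K K h -> ev c h = F (ev a h) (ev b h)) ->
  has_series (fun x => F (f x) (g x)) p c.
Proof.
move=> ha hb H.
have [K K0 [mA mB]] := near_pinfty_ex (filterI (series_maj ha) (series_maj hb)).
have [D mc Ec] := H K _ _ K0 mA mB.
apply: (maj_series K0 K0 mc); near=> x.
rewrite Ec; last by near: x; exact: near_small.
by congr F; near: x; exact: series_ev.
Unshelve. all: by end_near. Qed.

Lemma has_series_add f g p a b : has_series f p a -> has_series g p b ->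
  has_series (fun x => f x + g x) p (fun i j => a i j + b i j).
Proof.
move=> ha hb; apply: (has_series2 ha hb) => K A B K0 mA mB.
exists (A + B); first exact: maj_add.
by move=> h sh; rewrite (ev_add _ _ sh mA mB) ?ltW.
Qed.

Lemma has_series_mul f g p a b : has_series f p a -> has_series g p b ->
  has_series (fun x => f x * g x) p (fmul a b).
Proof.
move=> ha hb; apply: (has_series2 ha hb) => K A B K0 mA mB.
exists (A * B); first by apply: maj_mul => //; exact: ltW.
by move=> h sh; rewrite (ev_mul _ _ sh mA mB) ?ltW.
Qed.

Lemma has_series_scale f p a (c : R) : has_series f p a ->
  has_series (fun x => c * f x) p (fun i j => c * a i j).
Proof.
move=> ha; apply: (has_series2 (F := fun u v => c * u) ha ha) => K A B K0 mA mB.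
exists (`|c| * A); first exact: maj_scale.
by move=> h sh; rewrite (ev_scale _ _ _ sh mA) ?ltW.
Qed.

Lemma analytic_cst (c : R) p : analytic_at (fun=> c) p.
Proof. by eexists; exact: has_series_cst. Qed.

Lemma analytic_coord k p : analytic_at (fun x => x 0 k) p.
Proof. by eexists; exact: has_series_coord. Qed.

Lemma analytic_add f g p : analytic_at f p -> analytic_at g p ->
  analytic_at (fun x => f x + g x) p.
Proof. by move=> [a ha] [b hb]; eexists; exact: (has_series_add ha hb). Qed.

Lemma analytic_mul f g p : analytic_at f p -> analytic_at g p ->
  analytic_at (fun x => f x * g x) p.
Proof. by move=> [a ha] [b hb]; eexists; exact: (has_series_mul ha hb). Qed.

Lemma analytic_near_eq f g p : analytic_at f p -> (\forall x \near p, f x = g x) ->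
  analytic_at g p.
Proof.
move=> [a ha] fg; exists a; near=> x.
have <- : f x = g x by near: x.
by near: x.
Unshelve. all: by end_near. Qed.

(** The order of quantifiers in [lifts] matters here: [d] is fixed first, then [K] is taken so large
    that the series of the [u i] without constant terms are majorised by [d]. *)
Lemma lifts_analytic (t : ('I_2 -> R) -> R) (u : 'I_2 -> 'rV[R]_2 -> R) p :
  lifts t (fun i => u i p) -> (forall i, analytic_at (u i) p) ->
  analytic_at (fun x => t (fun i => u i x)) p.
Proof.
move=> [T [_ HT]] /choice[a ha].
have [d d0 Hd] := HT 1 ltr01.
pose v k i j := a k i j - fcst (a k 0%N 0%N) i j.
have [K K0 mv] : exists2 K, 0 < K & forall k, maj K K d (v k).
  have [K K0 [m0 m1]] := near_pinfty_ex
    (filterI (series_small d0 (ha 0)) (series_small d0 (ha 1))).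
  by exists K => //; apply: ord2P.
have [mT ET] := Hd K K v K0 K0 mv.
exists (T v); apply: (maj_series K0 K0 (maj_from_sub mT (maj_fcst _ (ltW K0) (ltW K0)))).
have H k : \forall x \near p, u k x = u k p + ev (v k) (x - p).
  have mc := maj_fcst (a k 0%N 0%N) (ltW K0) (ltW K0).
  near=> x; have sx : small K K (x - p) by near: x; exact: near_small.
  rewrite (ev_sub (ltW K0) (ltW K0) sx (maj_from_sub (mv k) mc) mc) ev_fcst.
  rewrite (series_at (ha k)) addrC subrK; near: x; exact: (series_ev (ha k)).
have H0 := H 0; have H1 := H 1.
near=> x; rewrite ET; last by near: x; exact: near_small.
by congr t; apply/funext; apply: ord2P; near: x.
Unshelve. all: by end_near. Qed.

Lemma analytic_comp f (u : 'I_2 -> 'rV[R]_2 -> R) p :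
  analytic_at f (\row_k u k p) -> (forall k, analytic_at (u k) p) ->
  analytic_at (fun x => f (\row_k u k x)) p.
Proof.
move=> af au; apply: (@lifts_analytic (fun w => f (\row_k w k))) => //.
by apply: lifts_comp => // k; exact: lifts_proj.
Qed.

(** Re-expansion at [q] is the composition of the series at [p] with the translation by q - p. Its
    small constant term takes half of [d], the variable the other half. *)
Lemma analytic_near f p : analytic_at f p -> \forall q \near p, analytic_at f q.
Proof.
move=> af.
have : lifts (fun w : 'I_2 -> R => f (\row_k w k)) (fun k => p 0 k).
  apply: lifts_comp => [|k]; last exact: lifts_proj.
  by rewrite (_ : \row_k _ = p)//; apply/rowP => k; rewrite mxE.
move=> [T [_ HT]]; have [d d0 Hd] := HT 1 ltr01.
have [K K0 hK] : exists2 K, 0 < K & 64 / K <= d / 2.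
  exists (128 / d); first by rewrite divr_gt0.
  by rewrite (_ : 64 / (128 / d) = d / 2)//; field; rewrite gt_eqF.
near=> q.
have hq k : 16 * `|(q - p) 0 k| <= d / 2.
  rewrite mulrC -ler_pdivlMr//; move: k; near: q; apply: near_coord.
  by rewrite !divr_gt0.
pose v k i j := fcst ((q - p) 0 k) i j + fvar k i j.
have mv k : maj K K d (v k).
  have := maj_add (maj_fcst ((q - p) 0 k) (ltW K0) (ltW K0)) (maj_var k K0).
  by apply: maj_wid; [exact: ltW|exact: ltW|have := hq k; lra].
have [mT ET] := Hd K K v K0 K0 mv.
exists (T v); apply: (maj_series K0 K0 (maj_from_sub mT (maj_fcst _ (ltW K0) (ltW K0)))).
near=> x; have sx : small K K (x - q) by near: x; exact: near_small.
rewrite ET//; congr f; apply/rowP => k; rewrite mxE.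
rewrite (ev_add (ltW K0) (ltW K0) sx (maj_fcst _ (ltW K0) (ltW K0)) (maj_var k K0)).
by rewrite ev_fcst ev_var !mxE; lra.
Unshelve. all: by end_near. Qed.

Lemma analytic_continuous f p : analytic_at f p -> {for p, continuous f}.
Proof.
move=> [a ha].
have [K K0 mA] := near_pinfty_ex (series_maj ha).
have fE := series_ev ha.
rewrite /prop_for /continuous_at.
apply: (@cvg_trans _ (ev a (x - p) @[x --> p])).
  by apply: (near_eq_cvg (F := nbhs p)); apply: filterS fE => x ->.
rewrite (nbhs_singleton fE).
apply: (dsum_cvg (F := nbhs p) (B := (1 + 16 * `|a 0%N 0%N|) / 16)
  (u := fun x i j => power_term a (x - p) (i, j))
  (s := fun i j => power_term a (p - p) (i, j))).
- near=> x; apply: maj_geo mA; rewrite ?ltW//; near: x; exact: near_small.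
- by apply: maj_geo mA; rewrite ?ltW// => k; rewrite subrr mxE normr0 mul0r invr_ge0.
- have cx k : (x - p) 0 k @[x --> p] --> (p - p) 0 k.
    rewrite (_ : (fun x => (x - p) 0 k) = fun x => x 0 k - p 0 k); last first.
      by apply/funext => x; rewrite !mxE.
    by rewrite !mxE; exact: (cvgB (@coord_continuous R 1 2 0 k p) (cvg_cst _)).
  have cxn k n : (x - p) 0 k ^+ n @[x --> p] --> (p - p) 0 k ^+ n.
    exact: (cvg_comp _ _ (cx k) (@exprn_continuous R n _)).
  move=> i j; rewrite /power_term /=; apply: cvgM; last exact: cxn.
  by apply: cvgMr; exact: cxn.
Unshelve. all: by end_near. Qed.

End Analytic.

(** * The analytic inverse function theorem *)

Section InverseFunction.
Context {R : realType}.
Implicit Types (a b f : nat -> nat -> R) (A C S K d : R) (p x y : 'rV[R]_2).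
Implicit Types (u v h : 'I_2 -> nat -> nat -> R).

(** Each application of [T] settles one more grade, so the n-th iterate is final in all grades below
    n and the limit is read off diagonally. Since [P] constrains each coefficient separately, it
    holds for the limit as well. *)
Lemma causal_fixpoint (gr : nat -> nat -> nat) (P : 'I_2 -> nat -> nat -> R -> Prop)
    (T : ('I_2 -> nat -> nat -> R) -> 'I_2 -> nat -> nat -> R) u0 :
  let ok u := forall k i j, P k i j (u k i j) in
  ok u0 -> (forall u, ok u -> ok (T u)) ->
  (forall n u v, ok u -> ok v -> (forall k, agree gr n (u k) (v k)) ->
     forall k, agree gr n.+1 (T u k) (T v k)) ->
  exists2 u, ok u & T u = u.
Proof.
move=> ok ok0 okT Tc; pose w n := iter n T u0.
have okw n : ok (w n) by elim: n => [//|n IH]; exact: okT.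
have ag n m k : agree gr n (w n k) (w (n + m)%N k).
  elim: n m k => [//|n IH] m k; rewrite addSn.
  by apply: Tc; [exact: okw|exact: okw|move=> k'; exact: IH].
pose u k i j := w (gr i j).+1 k i j.
have uw n k : agree gr n (u k) (w n k).
  move=> i j gn; rewrite /u (ag _ (n - (gr i j).+1)%N k) ?leqnn//.
  by rewrite subnKC.
have oku : ok u by move=> k i j; exact: okw.
exists u => //; apply/funext => k; apply/funext => i; apply/funext => j.
by rewrite (Tc (gr i j) u (w (gr i j)) oku (okw _) (uw _) k).
Qed.

(** * Order of vanishing and the gain of one degree *)

Lemma order_le m n a : (m <= n)%N -> vanish n a -> vanish m a.
Proof. by move=> mn oa i j ij; apply: oa; exact: leq_trans mn. Qed.

Lemma order_mul m n a b : vanish m a -> vanish n b -> vanish (m + n) (fmul a b).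
Proof.
move=> oa ob i j ij; rewrite /fmul big1// => q _; rewrite big1// => r _.
have qi : (q <= i)%N by rewrite -ltnS.
have rj : (r <= j)%N by rewrite -ltnS.
have [h|h] := ltnP (q + r) m; first by rewrite oa// mul0r.
by rewrite ob ?mulr0//; lia.
Qed.

Lemma order_mono k l u : (forall i, vanish 1 (u i)) -> vanish (k + l) (fmono k l u).
Proof.
move=> ou; elim: k => [|k IH]; last exact: (@order_mul 1).
by elim: l => [//|l IH]; exact: (@order_mul 1).
Qed.

Lemma order_comp m f u : vanish m f -> (forall i, vanish 1 (u i)) ->
  vanish m (fcomp f u).
Proof.
move=> of_ ou i j ij; rewrite /fcomp (@dsum_fin _ _ 0) ?/sqsum ?big_ord0// => k l _.
have [h|h] := ltnP (k + l) m; first by rewrite of_// mul0r.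
by rewrite (order_mono ou) ?mulr0//; lia.
Qed.

(** Both factors have positive degree, so a term of total degree n involves only coefficients of
    degree less than n. This is the source of causality for nonlinear terms. *)
Lemma agree_mul1 n a a' b b' :
  vanish 1 a -> vanish 1 a' -> vanish 1 b -> vanish 1 b' ->
  agree addn n a a' -> agree addn n b b' -> agree addn n.+1 (fmul a b) (fmul a' b').
Proof.
move=> oa oa' ob ob' aa bb i j ij; apply: eq_bigr => q _; apply: eq_bigr => r _.
have qi : (q <= i)%N by rewrite -ltnS.
have rj : (r <= j)%N by rewrite -ltnS.
have [h1|h1] := ltnP (q + r) 1; first by rewrite oa// oa'// !mul0r.
have [h2|h2] := ltnP (i - q + (j - r)) 1; first by rewrite ob// ob'// !mulr0.
by rewrite aa ?bb//; lia.
Qed.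

Lemma grading_addn : grading addn.
Proof. by move=> *; exact: leq_add. Qed.

Lemma agree_mono1 n k l u v : (1 < k + l)%N ->
  (forall i, vanish 1 (u i)) -> (forall i, vanish 1 (v i)) ->
  (forall i, agree addn n (u i) (v i)) ->
  agree addn n.+1 (fmono k l u) (fmono k l v).
Proof.
move=> kl ou ov uv; case: k kl => [|k] kl.
  case: l kl => [//|l] kl; apply: (@agree_mul1 n (u 1) (v 1) (fmono 0 l u) (fmono 0 l v)) => //.
  - exact: (@order_le 1 (0 + l) _ kl (order_mono ou)).
  - exact: (@order_le 1 (0 + l) _ kl (order_mono ov)).
  - exact: (agree_mono 0 l grading_addn uv).
apply: (@agree_mul1 n (u 0) (v 0) (fmono k l u) (fmono k l v)) => //.
- exact: (@order_le 1 (k + l) _ kl (order_mono ou)).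
- exact: (@order_le 1 (k + l) _ kl (order_mono ov)).
- exact: (agree_mono k l grading_addn uv).
Qed.

Lemma agree_comp1 n f u v : vanish 2 f ->
  (forall i, vanish 1 (u i)) -> (forall i, vanish 1 (v i)) ->
  (forall i, agree addn n (u i) (v i)) ->
  agree addn n.+1 (fcomp f u) (fcomp f v).
Proof.
move=> of_ ou ov uv i j ij; congr dsum; apply/funext => k; apply/funext => l.
have [h|h] := ltnP (k + l) 2; first by rewrite of_// !mul0r.
by rewrite (agree_mono1 h ou ov uv).
Qed.

Lemma order_var k : vanish 1 (@fvar R k).
Proof. by move: k; apply: ord2P => -[|i] [|j]. Qed.

Lemma ev_compE C S K d f u x : 0 < K -> 0 < S -> S * d <= 2^-1 ->
  small K K x -> bnd C S f -> (forall i, maj K K d (u i)) ->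
  ev (fcomp f u) x = ev f (\row_i ev (u i) x).
Proof.
move=> K0 S0 Sd sx bf mu; apply/esym/cvg_dsum.
exact: (ev_comp (ltW K0) (ltW K0) (ltW S0) Sd sx bf mu).
Qed.

Lemma maj_bnd K A a : 0 < K -> maj K K A a -> bnd A (2 * K) a.
Proof.
move=> K0 ma i j; apply: le_trans (ma i j) _; rewrite ler_wpM2l ?(maj_ge0 ma)//.
apply: le_trans (wt_le i j (ltW K0) (ltW K0)) _.
rewrite (_ : K + K = 2 * K); last by ring.
by rewrite ler_piMl ?exprn_ge0 ?mulr_ge0 ?ltW//; lra.
Qed.

Lemma formal_inverse h C S : 0 < S -> (forall k, bnd C S (h k)) ->
  (forall k, vanish 2 (h k)) ->
  exists K d u, [/\ 0 < K, S * d <= 2^-1, forall k, maj K K d (u k),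
    forall k, vanish 1 (u k) & forall k i j, u k i j = fvar k i j - fcomp (h k) u i j].
Proof.
move=> S0 bh oh; have C0 := bnd_ge0 (bh 0).
(* Order 2 of [h] gives the bound 128 C (2 S d)^2 = 512 Q d^2, at most d / 2 as soon as 1024 Q d <=
   1. The other half of [d] is left to the variable, by the choice 64 / K = d / 2. *)
pose Q := C * S ^+ 2; have Q0 : 0 <= Q by rewrite mulr_ge0 ?sqr_ge0.
pose D := 1024 * Q + 1.
have D0 : 0 < D by rewrite /D; lra.
pose d := Num.min (2 * S)^-1 D^-1.
have d0 : 0 < d by rewrite lt_min !invr_gt0 mulr_gt0.
have Sd : S * d <= 2^-1.
  have : d <= (2 * S)^-1 by rewrite ge_min lexx.
  by rewrite -div1r ler_pdivlMr ?mulr_gt0// => h'; lra.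
have dD : 128 * C * (2 * (S * d)) ^+ 2 <= d / 2.
  have : d <= D^-1 by rewrite ge_min lexx orbT.
  rewrite -div1r ler_pdivlMr// /D => h'.
  have -> : 128 * C * (2 * (S * d)) ^+ 2 = d * (512 * (Q * d)) by rewrite /Q; ring.
  by apply: ler_wpM2l (ltW d0) _ _ _; lra.
pose K := 128 / d.
have K0 : 0 < K by rewrite divr_gt0.
have KE : 64 / K = d / 2 by rewrite /K; field; rewrite gt_eqF.
exists K, d.
have K1 := ltW K0.
pose P (k : 'I_2) i j (r : R) := `|r| <= d * wt K K i j /\ ((i + j < 1)%N -> r = 0).
pose T u k i j : R := fvar k i j - fcomp (h k) u i j.
have [| | |u oku Tu] := @causal_fixpoint addn P T (fun _ _ _ => 0).
- by move=> k i j; split => //; rewrite normr0 mulr_ge0 ?wt_ge0// ltW.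
- move=> u oku.
  have mu k : maj K K d (u k) by move=> i j; exact: (oku k i j).1.
  have ou k : vanish 1 (u k) by move=> i j; exact: (oku k i j).2.
  move=> k i j; split.
    have := maj_sub (maj_var k K0) (maj_comp K1 K1 (ltW S0) Sd (bh k) (oh k) mu) i j.
    move=> /le_trans; apply; rewrite ler_wpM2r ?wt_ge0// KE.
    by rewrite [leRHS](_ : d = d / 2 + d / 2) ?lerD2l//; field.
  move=> ij; rewrite /T (order_var k) // (order_comp (oh k) ou) ?subr0//.
  exact: ltn_trans ij _.
- move=> n u v oku okv uv k i j ij; rewrite /T; congr (_ - _).
  apply: (agree_comp1 (oh k) _ _ uv) => //.
    by move=> l i' j'; exact: (oku l i' j').2.
  by move=> l i' j'; exact: (okv l i' j').2.
exists u; split => //.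
- by move=> k i j; exact: (oku k i j).1.
- by move=> k i j; exact: (oku k i j).2.
- by move=> k i j; rewrite -{1}Tu.
Qed.

(* Near [0], [nearid h] is tangent to the identity when [h] vanishes to order 2. *)
Definition nearid h x : 'rV[R]_2 := \row_k (x 0 k + ev (h k) x).

Lemma row_continuous (F : 'rV[R]_2 -> 'rV[R]_2) p :
  (forall k, {for p, continuous (fun x => F x 0 k)}) -> {for p, continuous F}.
Proof.
move=> cF A /nbhs_ballP[e /= e0 eA].
have c k : \forall x \near p, `|F p 0 k - F x 0 k| < e.
  by have /cvgrPdist_lt/(_ e e0) := cF k.
have c0 := c 0; have c1 := c 1.
suff : \forall x \near p, A (F x) by [].
near=> x; apply: eA; split => // i k; rewrite (ord1 i).
by move: k; apply: ord2P; near: x.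
Unshelve. all: by end_near. Qed.

Lemma analytic_ext (f g : 'rV[R]_2 -> R) p : (forall x, f x = g x) ->
  analytic_at f p -> analytic_at g p.
Proof. by move=> /funext ->. Qed.

Lemma bnd_series C S a : 0 < S -> bnd C S a -> has_series (fun x => ev a x) 0 a.
Proof.
move=> S0 ba.
have [K K0 mK] := near_pinfty_ex (bnd_maj S0 ltr01 (bnd_sub0 S0 ba) (@drop_order1 _ a)).
have mc := maj_fcst (a 0%N 0%N) (ltW K0) (ltW K0).
apply: (maj_series K0 K0 (maj_from_sub mK mc)).
by near=> x; rewrite subr0.
Unshelve. all: by end_near. Qed.

Lemma analytic_nearid h C S k : 0 < S -> (forall k, bnd C S (h k)) ->
  analytic_at (fun x => nearid h x 0 k) 0.
Proof.
move=> S0 bh; have H := bnd_series S0 (bh k).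
apply: (@analytic_ext (fun x => x 0 k + ev (h k) x)) => [x|]; first by rewrite mxE.
by apply: analytic_add; [exact: analytic_coord|exists (h k)].
Qed.

Lemma nearid0 h : (forall k, vanish 2 (h k)) -> nearid h 0 = 0.
Proof.
by move=> oh; apply/rowP => k; rewrite !mxE ev_at0 oh// addr0.
Qed.

Lemma nearid_continuous h C S : 0 < S -> (forall k, bnd C S (h k)) ->
  (forall k, vanish 2 (h k)) -> nearid h x @[x --> (0 : 'rV[R]_2)] --> (0 : 'rV[R]_2).
Proof.
move=> S0 bh oh; rewrite -[X in _ --> X](nearid0 oh).
apply: row_continuous => k; apply: analytic_continuous.
exact: analytic_nearid S0 bh.
Qed.

(** For the solution of u = x - h(u), the remainder -h(u) again has order 2 and geometric bounds, so
    the solution has the same form as the original map. *)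
Lemma nearid_right_inverse h C S : 0 < S -> (forall k, bnd C S (h k)) ->
  (forall k, vanish 2 (h k)) ->
  exists h' C' S', [/\ 0 < S', forall k, bnd C' S' (h' k), forall k, vanish 2 (h' k) &
    \forall x \near (0 : 'rV[R]_2), nearid h (nearid h' x) = x].
Proof.
move=> S0 bh oh; have [K [d [u [K0 Sd mu ou uE]]]] := formal_inverse S0 bh oh.
have K1 := ltW K0.
have mcomp k := maj_comp K1 K1 (ltW S0) Sd (bh k) (oh k) mu.
pose h' k i j := -1 * fcomp (h k) u i j.
have mh' k := maj_scale (-1) (mcomp k).
have Ex k x : small K K x -> ev (u k) x = x 0 k - ev (fcomp (h k) u) x.
  move=> sx; rewrite -ev_var -(ev_sub K1 K1 sx (maj_var k K0) (mcomp k)).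
  by congr ev; apply/funext => i; apply/funext => j.
exists h'; eexists; exists (2 * K); split; first by rewrite mulr_gt0.
- by move=> k; exact: maj_bnd K0 (mh' k).
- by move=> k i j ij; rewrite /h' (order_comp (oh k) ou) ?mulr0.
near=> x.
have sx : small K K x.
  by rewrite -[x]subr0; near: x; exact: near_small.
have E : nearid h' x = \row_k ev (u k) x.
  apply/rowP => k; rewrite !mxE Ex// /h' (ev_scale _ K1 K1 sx (mcomp k)).
  by rewrite mulN1r.
rewrite E; apply/rowP => k; rewrite !mxE -(ev_compE K0 S0 Sd sx (bh k) mu) Ex//.
by rewrite subrK.
Unshelve. all: by end_near. Qed.

(* A right inverse is again tangent to the identity, so it has a right inverse
   too, which must then be the original map. *)
Lemma nearid_inverse h C S : 0 < S -> (forall k, bnd C S (h k)) ->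
  (forall k, vanish 2 (h k)) ->
  exists h', [/\ forall k, analytic_at (fun x => nearid h' x 0 k) 0,
    nearid h' 0 = 0,
    \forall x \near (0 : 'rV[R]_2), nearid h (nearid h' x) = x &
    \forall x \near (0 : 'rV[R]_2), nearid h' (nearid h x) = x].
Proof.
move=> S0 bh oh.
have [h' [C' [S' [S'0 bh' oh' hh']]]] := nearid_right_inverse S0 bh oh.
have [h'' [C'' [S'' [S''0 bh'' oh'' hh'']]]] := nearid_right_inverse S'0 bh' oh'.
exists h'; split; [|exact: nearid0|exact: hh'|].
  by move=> k; exact: analytic_nearid S'0 bh'.
have c := nearid_continuous S''0 bh'' oh''.
have cc : \forall x \near (0 : 'rV[R]_2),
  nearid h (nearid h' (nearid h'' x)) = nearid h'' x := c _ hh'.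
near=> x.
have e1 : nearid h' (nearid h'' x) = x by near: x.
have <- : nearid h'' x = nearid h x by rewrite -{2}e1; apply/esym; near: x.
by [].
Unshelve. all: by end_near. Qed.

(* Entry [(j, k)] of the matrix is the coefficient of the [j]-th variable in the
   [k]-th component, whose exponent pair is [(1 - j, j)]. *)
Theorem inverse_function (F : 'rV[R]_2 -> 'rV[R]_2) p
    (a : 'I_2 -> nat -> nat -> R) :
  (forall k, has_series (fun x => F x 0 k) p (a k)) ->
  (\matrix_(j < 2, k < 2) a k (1 - j)%N j) \in unitmx ->
  exists G : 'rV[R]_2 -> 'rV[R]_2,
    [/\ G (F p) = p, forall k, analytic_at (fun y => G y 0 k) (F p),
     \forall x \near p, G (F x) = x & \forall y \near F p, F (G y) = y].
Proof.
set A := \matrix_(j, k) _ => ha uA; set q := F p; pose B := invmx A.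
have cF k : q 0 k = a k 0%N 0%N by rewrite -(series_at (ha k)).
(* Multiplying by the inverse [B] of the linear part reduces to a map tangent to the identity: [h]
   is the series of (F x - q) B - (x - p), with [c] collecting the constants p - q B. *)
pose c k := p 0 k - (q *m B) 0 k.
pose h k i j := (B 0 k * a 0 i j + B 1 k * a 1 i j) +
  (fcst (c k) i j + -1 * (fcst (p 0 k) i j + fvar k i j)).
have mulB (v : 'rV[R]_2) k : (v *m B) 0 k = v 0 0 * B 0 k + v 0 1 * B 1 k.
  by rewrite mxE !big_ord_recl big_ord0 addr0; congr (_ * _ + _ 0 _ * B _ _); apply: val_inj.
have hs k : has_series (fun x => ((F x - q) *m B) 0 k - (x - p) 0 k) p (h k).
  have := has_series_add
    (has_series_add (has_series_scale (B 0 k) (ha 0)) (has_series_scale (B 1 k) (ha 1)))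
    (has_series_add (has_series_cst (c k) p)
       (has_series_scale (-1) (has_series_coord k p))).
  congr has_series; apply/funext => x; rewrite mulB !mxE /c mulB; ring.
have AB : A *m B = 1%:M by rewrite mulmxV.
have oh k : vanish 2 (h k).
  have ABE (j : 'I_2) : B 0 k * a 0 (1 - j)%N j + B 1 k * a 1 (1 - j)%N j = (j == k)%:R.
    have := congr1 (fun M : 'M[R]_2 => M j k) AB.
    rewrite !mxE !big_ord_recl big_ord0 addr0 !mxE => <-.
    by rewrite ![_ * B _ _]mulrC; congr (_ * _ + B _ k * a _ _ _); apply: val_inj.
  have e0 := ABE 0; have e1 := ABE 1; rewrite subn0 in e0; rewrite subnn in e1.
  have vE : (0 == k)%:R = fvar k 1 0 :> R /\ (1 == k)%:R = fvar k 0 1 :> R.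
    by move: k {e0 e1 ABE}; apply: ord2P.
  case=> [|[|i]] [|[|j]] // _; rewrite /h /fcst /=.
  - rewrite -!cF (order_var k)// /c mulB; ring.
  - by rewrite e1 vE.2; ring.
  - by rewrite e0 vE.1; ring.
have [C [S [S0 bh]]] : exists C S, 0 < S /\ forall k, bnd C S (h k).
  have [C0 [S0 [S00 b0]]] := series_bnd (hs 0).
  have [C1 [S1 [S10 b1]]] := series_bnd (hs 1).
  exists (C0 + C1), (S0 + S1); split; first exact: addr_gt0.
  have C00 := bnd_ge0 b0; have C10 := bnd_ge0 b1.
  have wid C S C' S' b : 0 <= C -> 0 < S -> C <= C' -> S <= S' -> bnd C S b -> bnd C' S' b.
    move=> c0 s0 cc ss bb k l; apply: le_trans (bb k l) _.
    by rewrite ler_pM ?exprn_ge0 ?(ltW s0)// lerXn2r ?nnegrE ?(le_trans (ltW s0))// ltW.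
  apply: ord2P; [apply: wid b0|apply: wid b1] => //;
    by rewrite ?lerDl ?lerDr// ltW.
have NF : \forall x \near p, nearid h (x - p) = (F x - q) *m B.
  have s0 := series_ev (hs 0); have s1 := series_ev (hs 1).
  near=> x; apply/rowP; apply: ord2P; rewrite mxE.
    have <- : ((F x - q) *m B) 0 0 - (x - p) 0 0 = ev (h 0) (x - p) by near: x.
    by rewrite addrC subrK.
  have <- : ((F x - q) *m B) 0 1 - (x - p) 0 1 = ev (h 1) (x - p) by near: x.
  by rewrite addrC subrK.
have [h' [ah' h'0 hh' h'h]] := nearid_inverse S0 bh oh.
pose G y := p + nearid h' ((y - q) *m B).
have Gq : G q = p by rewrite /G subrr mul0mx h'0 addr0.
have alin k y : analytic_at (fun y => ((y - q) *m B) 0 k) y.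
  have aco l : analytic_at (fun y : 'rV[R]_2 => (- q 0 l + y 0 l) * B l k) y.
    by apply: analytic_mul (analytic_cst _ _); apply: analytic_add (analytic_coord _ _); exact: analytic_cst.
  have [b hb] := analytic_add (aco 0) (aco 1); exists b; move: hb; congr has_series.
  by apply/funext => z; rewrite mulB !mxE; ring.
have clin : (y - q) *m B @[y --> q] --> (0 : 'rV[R]_2).
  rewrite -[X in _ --> X](mul0mx _ B) -(subrr q).
  by apply: (row_continuous (F := fun y => (y - q) *m B)) => k; exact: analytic_continuous.
have aG k : analytic_at (fun y => G y 0 k) q.
  have af : analytic_at (fun x => nearid h' x 0 k) (\row_j ((q - q) *m B) 0 j).
    rewrite (_ : \row_j _ = 0); first exact: ah'.
    by apply/rowP => j; rewrite subrr mul0mx !mxE.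
  apply: (@analytic_ext (fun y => p 0 k + nearid h' (\row_j ((y - q) *m B) 0 j) 0 k)).
    move=> y; rewrite /G [RHS]mxE; congr (_ + nearid h' _ 0 k).
    by apply/rowP => j; rewrite mxE.
  by apply: analytic_add; [exact: analytic_cst|exact: (analytic_comp af)].
exists G; split; [exact: Gq|exact: aG| |].
  have cx : x - p @[x --> p] --> (0 : 'rV[R]_2).
    by rewrite -[X in _ --> X](subrr p); exact: (cvgB cvg_id (cvg_cst _)).
  have := cx _ h'h; rewrite /= => H; near=> x; rewrite /G.
  have <- : nearid h (x - p) = (F x - q) *m B by near: x.
  have -> : nearid h' (nearid h (x - p)) = x - p by near: x.
  by rewrite addrC subrK.
have cG : G y @[y --> q] --> p.
  rewrite -[X in _ --> X]Gq; apply: row_continuous => k; exact: analytic_continuous.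
have H1 := cG _ NF; have H2 := clin _ hh'; near=> y.
have : (F (G y) - q) *m B = (y - q) *m B.
  have <- : nearid h (G y - p) = (F (G y) - q) *m B by near: y.
  rewrite /G addrAC subrr add0r; by near: y.
move=> /(congr1 (mulmx^~ A)) /=; rewrite -!mulmxA mulVmx// !mulmx1.
by move/addIr.
Unshelve. all: by end_near. Qed.

End InverseFunction.

(** * Quotients and square roots *)

Section QuotientSqrt.
Context {R : realType}.
Implicit Types (p x y : 'rV[R]_2) (f : 'rV[R]_2 -> R).

Lemma det2 (A : 'M[R]_2) : \det A = A 0 0 * A 1 1 - A 0 1 * A 1 0.
Proof.
rewrite (expand_det_row _ 0) !big_ord_recl big_ord0 addr0 /cofactor !det_mx11 !mxE.
rewrite /= expr0 expr1 mul1r mulN1r mulrN.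
by congr (_ * A _ _ - A _ _ * A _ _); apply: val_inj.
Qed.

Definition row2 (r s : R) : 'rV[R]_2 := \row_k (if k == 0 then r else s).

Lemma row2P x : x = row2 (x 0 0) (x 0 1).
Proof. by apply/rowP; apply: ord2P; rewrite mxE. Qed.

(** A local inverse of [F] applied to [u] gives [v]. The condition on [a] is the nonvanishing of the
    Jacobian of [F] at [q]. *)
Lemma analytic_solve (F : 'rV[R]_2 -> 'rV[R]_2) q (a : 'I_2 -> nat -> nat -> R)
    (u : 'I_2 -> 'rV[R]_2 -> R) p :
  (forall k, has_series (fun x => F x 0 k) q (a k)) ->
  a 0 1 0 * a 1 0 1 - a 1 1 0 * a 0 0 1 != 0 ->
  (forall k, analytic_at (u k) p) -> F q = \row_k u k p ->
  exists v : 'I_2 -> 'rV[R]_2 -> R,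
    [/\ forall k, analytic_at (v k) p, forall k, v k p = q 0 k &
       \forall x \near p, F (\row_k v k x) = \row_k u k x].
Proof.
move=> ha da au Fq.
have uA : (\matrix_(j < 2, k < 2) a k (1 - j)%N j) \in unitmx.
  by rewrite unitmxE det2 !mxE unitfE.
have [G [Gq aG _ FG]] := inverse_function ha uA.
have cu : \row_k u k x @[x --> p] --> \row_k u k p.
  apply: (row_continuous (F := fun x => \row_k u k x)) => k.
  apply: analytic_continuous; apply: (analytic_ext _ (au k)) => x.
  by rewrite mxE.
exists (fun k x => G (\row_k u k x) 0 k); split.
- move=> k; apply: (analytic_comp (f := fun y => G y 0 k)) => //.
  by rewrite -Fq.
- by move=> k; rewrite -Fq Gq.
- rewrite Fq in FG; have := cu _ FG; rewrite /= => H; near=> x.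
  rewrite (_ : \row_k _ = G (\row_k u k x)); first by near: x.
  by apply/rowP => k; rewrite mxE.
Unshelve. all: by end_near. Qed.

Lemma near_neq0 f p : analytic_at f p -> f p != 0 -> \forall x \near p, f x != 0.
Proof.
move=> /analytic_continuous cf fp.
have := cf [set z | z != 0]; apply.
by apply: open_nbhs_nbhs; split => //; exact: open_neq.
Qed.

Lemma near_gt0 f p : analytic_at f p -> 0 < f p -> \forall x \near p, 0 < f x.
Proof. by move=> /analytic_continuous cf fp; exact: (cvgr_gt (f p) cf). Qed.

(* The reciprocal comes from inverting [(y_1, y_2) |-> (y_1 y_2, y_2)], the
   square root from inverting [(y_1, y_2) |-> (y_1 ^ 2, y_2)]. *)
Lemma analytic_inv f p : analytic_at f p -> f p != 0 ->
  analytic_at (fun x => (f x)^-1) p.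
Proof.
move=> af f0.
pose F y := row2 (y 0 0 * y 0 1) (y 0 1); pose q := row2 (f p)^-1 (f p).
pose c k i j := fcst (q 0 k) i j + @fvar R k i j.
pose a (k : 'I_2) := if k == 0 then fmul (c 0) (c 1) else c 1.
have [||| |v [av _ Fv]] := @analytic_solve F q a (fun k x => if k == 0 then 1 else f x) p.
- apply: ord2P.
    have := has_series_mul (has_series_coord 0 q) (has_series_coord 1 q).
    by congr has_series; apply/funext => y; rewrite mxE.
  have := has_series_coord 1 q.
  by congr has_series; apply/funext => y; rewrite mxE.
- rewrite /a /= /fmul !big_ord_recl !big_ord0 /c /fcst /fvar /= /fvarx /fvary /= !mxE /=.
  by rewrite !(mul0r, mulr0, addr0, add0r, mul1r, mulr1, subr0).
- by apply: ord2P => //; exact: analytic_cst.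
- by apply/rowP; apply: ord2P; rewrite !mxE //= mulVf.
apply: (analytic_near_eq (av 0)); have fn := near_neq0 af f0.
near=> x; have fx : f x != 0 by near: x.
have E : F (\row_k v k x) = \row_k (if k == 0 then 1 else f x) by near: x.
have := congr1 (fun y : 'rV[R]_2 => y 0 0) E.
have := congr1 (fun y : 'rV[R]_2 => y 0 1) E.
rewrite !mxE /= => -> h; apply: (mulIf fx); by rewrite h mulVf.
Unshelve. all: by end_near. Qed.

Lemma analytic_sqrt f p : analytic_at f p -> 0 < f p ->
  analytic_at (fun x => Num.sqrt (f x)) p.
Proof.
move=> af f0; set s := Num.sqrt (f p); have s0 : 0 < s by rewrite sqrtr_gt0.
pose F y := row2 (y 0 0 * y 0 0) (y 0 1); pose q := row2 s 0.
pose c k i j := fcst (q 0 k) i j + @fvar R k i j.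
pose a (k : 'I_2) := if k == 0 then fmul (c 0) (c 0) else c 1.
have [||| |v [av vq Fv]] := @analytic_solve F q a (fun k x => if k == 0 then f x else 0) p.
- apply: ord2P.
    have := has_series_mul (has_series_coord 0 q) (has_series_coord 0 q).
    by congr has_series; apply/funext => y; rewrite mxE.
  have := has_series_coord 1 q.
  by congr has_series; apply/funext => y; rewrite mxE.
- rewrite /a /= /fmul !big_ord_recl !big_ord0 /c /fcst /fvar /= /fvarx /fvary /= !mxE /=.
  by rewrite !(mul0r, mulr0, addr0, add0r, mul1r, mulr1, subr0) gt_eqF// addr_gt0.
- by apply: ord2P => //; exact: analytic_cst.
- by apply/rowP; apply: ord2P; rewrite !mxE //= -expr2 sqr_sqrtr// ltW.
apply: (analytic_near_eq (av 0)).
(* The equation gives only v_0^2 = f; the value s > 0 at [p] selects the positive root nearby. *)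
have vn : \forall x \near p, 0 < v 0 x.
  by apply: near_gt0 => //; rewrite vq mxE.
near=> x; have vx : 0 < v 0 x by near: x.
have E : F (\row_k v k x) = \row_k (if k == 0 then f x else 0) by near: x.
have := congr1 (fun y : 'rV[R]_2 => y 0 0) E.
by rewrite !mxE /= => <-; rewrite -expr2 sqrtr_sqr gtr0_norm.
Unshelve. all: by end_near. Qed.

End QuotientSqrt.

(** * Termwise differentiation *)

Section Derivative.
Context {R : realType}.
Implicit Types (a b : nat -> nat -> R) (A B K L : R) (x : 'rV[R]_2).

Definition dx a i j : R := i.+1%:R * a i.+1 j.
Definition dy a i j : R := j.+1%:R * a i j.+1.

Lemma dsum_shift B (s : nat -> nat -> R) : geo B s -> (forall j, s 0%N j = 0) ->
  dsum (fun i j => s i.+1 j) = dsum s.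
Proof.
move=> gs s0; apply: cvg_dsum.
(* The row i = 0 vanishes, so shifted squares are (n + 1) by n rectangles, written with truncated
   subtraction to fit [rect_cvg]. *)
have -> : sqsum (fun i j => s i.+1 j) = fun n => rect s (n.+1 - 0)%N (n.+1 - 1)%N.
  apply/funext => n; rewrite subn0 subn1 /rect /= big_ord_recl.
  by rewrite [X in X + _]big1 ?add0r.
by rewrite (cvg_shiftS (fun n => rect s (n - 0)%N (n - 1)%N)); exact: rect_cvg gs.
Qed.

Lemma natr_le_exp2 n : n%:R * (4^-1 : R) ^+ n <= 2^-1 ^+ n.
Proof.
have -> : 4^-1 = 2^-1 * 2^-1 :> R by field.
rewrite exprMn mulrA ler_piMl ?exprn_ge0// exprVn ler_pdivrMr ?exprn_gt0// mul1r.
by rewrite -natrX ler_nat ltnW// ltn_expl.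
Qed.

(** The difference quotient of the n-th power between [y] and [y + t], written without division. *)
Definition dpow (y t : R) n := \sum_(i < n) (y + t) ^+ (n.-1 - i) * y ^+ i.

Lemma dpowE y t n : t != 0 -> t^-1 * ((y + t) ^+ n - y ^+ n) = dpow y t n.
Proof.
by move=> t0; rewrite subrXX addrAC subrr add0r mulKf.
Qed.

Lemma dpow_le y t r n : `|y| <= r -> `|y + t| <= r ->
  `|dpow y t n| <= n%:R * r ^+ n.-1.
Proof.
move=> yr ytr; rewrite (le_trans (ler_norm_sum _ _ _))//.
have r0 : 0 <= r by apply: le_trans yr.
rewrite mulr_natl -[X in _ *+ X](card_ord n) -sumr_const.
apply: ler_sum => i _; rewrite normrM !normrX.
have -> : n.-1 = (n.-1 - i + i)%N by have := ltn_ord i; lia.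
by rewrite exprD addnK ler_pM ?exprn_ge0// lerXn2r ?nnegrE.
Qed.

Lemma dpow_cvg y n : dpow y t n @[t --> 0^'] --> n%:R * y ^+ n.-1.
Proof.
have -> : n%:R * y ^+ n.-1 = \sum_(i < n) y ^+ (n.-1 - i) * y ^+ i.
  rewrite mulr_natl -[X in _ *+ X](card_ord n) -sumr_const.
  by apply: eq_bigr => i _; rewrite -exprD subnK//; have := ltn_ord i; lia.
apply: cvg_big => [|i _]; first exact: add_continuous.
apply: cvgM; last exact: cvg_cst.
have c : y + t @[t --> 0^'] --> y.
  rewrite -[X in _ --> X]addr0; apply: cvgD; first exact: cvg_cst.
  exact: (@nbhs_dnbhs R 0).
exact: (cvg_comp _ _ c (@exprn_continuous R _ _)).
Qed.

Lemma ev_dquot K A a (y z : R) : 0 < K -> maj K K A a ->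
  `|y| < (8 * K)^-1 -> `|z| <= (8 * K)^-1 ->
  t^-1 * (ev a (row2 (y + t) z) - ev a (row2 y z)) @[t --> 0^'] -->
  ev (dx a) (row2 y z).
Proof.
(* Up to a constant the terms of the difference quotient are bounded by i (2 K r)^(i+j). Since 2 K r
   = 1/4, [natr_le_exp2] absorbs the factor i and leaves powers of 1/2, so dominated convergence
   applies. *)
move=> K0 ma yK zK; set r := (8 * K)^-1 in yK zK.
have r0 : 0 < r by rewrite invr_gt0 mulr_gt0.
have rK : r * K = 8^-1 by rewrite /r; field; rewrite gt_eqF.
have A0 := maj_ge0 ma.
have ba i j : `|a i j| <= A / 16 * (2 * K) ^+ (i + j).
  apply: le_trans (ma i j) _; rewrite -mulrA ler_wpM2l//.
  apply: le_trans (wt_le i j (ltW K0) (ltW K0)) _.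
  by rewrite (_ : K + K = 2 * K); last ring.
pose g i j : R := A / 16 * (2 * K) ^+ (i + j).
have near_t : \forall t \near 0^', `|y + t| <= r.
  have c : `|y + t| @[t --> 0^'] --> `|y|.
    apply: cvg_norm; rewrite -[X in _ --> X]addr0; apply: cvgD; first exact: cvg_cst.
    exact: (@nbhs_dnbhs R 0).
  by near=> t; apply/ltW; near: t; exact: (cvgr_lt _ c _ yK).
have sm t : `|y + t| <= r -> small K K (row2 (y + t) z).
  move=> ytr; apply: ord2P; rewrite mxE /=.
    by have := ler_wpM2r (ltW K0) ytr; rewrite rK; lra.
  by have := ler_wpM2r (ltW K0) zK; rewrite rK; lra.
have sm0 : small K K (row2 y z) by rewrite -[y]addr0; apply: sm; rewrite addr0 ltW.
pose s t i j := a i j * dpow y t i * z ^+ j.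
pose l i j := a i j * (i%:R * y ^+ i.-1) * z ^+ j.
have gle i j : g i j * (i%:R * r ^+ i.-1) * r ^+ j <= A / 16 * r^-1 * 2^-1 ^+ (i + j).
  have c0 : 0 <= A / 16 * r^-1 by rewrite mulr_ge0 ?divr_ge0// invr_ge0 ltW.
  case: i => [|i]; first by rewrite mul0r mulr0 mul0r mulr_ge0// exprn_ge0 ?invr_ge0.
  have -> : g i.+1 j * (i.+1%:R * r ^+ i.+1.-1) * r ^+ j =
    A / 16 * r^-1 * (i.+1%:R * (2 * K * r) ^+ (i.+1 + j)).
    by rewrite /g !exprMn !exprD [r ^+ i.+1]exprS /=; field; exact: lt0r_neq0.
  rewrite (_ : 2 * K * r = 4^-1); last by rewrite -mulrA (mulrC K) rK; lra.
  rewrite ler_wpM2l// !exprD mulrA ler_pM ?mulr_ge0 ?exprn_ge0 ?natr_le_exp2//.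
  by rewrite lerXn2r ?nnegrE//; lra.
have gbound (D : R) i j : `|D| <= i%:R * r ^+ i.-1 ->
    `|a i j * D * z ^+ j| <= A / 16 * r^-1 * 2^-1 ^+ (i + j).
  move=> Di; apply: le_trans (gle i j); rewrite !normrM normrX.
  have z0 : `|z| ^+ j <= r ^+ j by rewrite lerXn2r ?nnegrE// ltW.
  by rewrite !ler_pM ?mulr_ge0 ?exprn_ge0.
have gs t : `|y + t| <= r -> geo (A / 16 * r^-1) (s t).
  by move=> ytr i j; apply: gbound; apply: dpow_le => //; exact: ltW.
have gl : geo (A / 16 * r^-1) l.
  move=> i j; apply: gbound; rewrite normrM normrX ger0_norm// ler_wpM2l//.
  by rewrite lerXn2r ?nnegrE// ltW.
have -> : ev (dx a) (row2 y z) = dsum l.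
  rewrite -(dsum_shift gl); last by move=> j; rewrite /l mul0r mulr0 mul0r.
  congr dsum; apply/funext => i; apply/funext => j.
  by rewrite /power_term /dx /l !mxE /=; ring.
apply: (@cvg_trans _ (dsum (s t) @[t --> 0^'])); last first.
  apply: (dsum_cvg (B := A / 16 * r^-1) (s := l)) => //.
    by near=> t; apply: gs; near: t.
  move=> i j; rewrite /s /l; apply: cvgM; last exact: cvg_cst.
  by apply: cvgMr; exact: dpow_cvg.
apply: near_eq_cvg; near=> t.
have t0 : t != 0 by near: t; exact: nbhs_dnbhs_neq.
have ytr : `|y + t| <= r by near: t.
have g1 := maj_geo (ltW K0) (ltW K0) (sm t ytr) ma.
have g2 := geoZ (-1) (maj_geo (ltW K0) (ltW K0) sm0 ma).
rewrite -mulN1r /ev -(dsumZ _ (maj_geo (ltW K0) (ltW K0) sm0 ma)) -(dsumD g1 g2) -(dsumZ _ (geoD g1 g2)).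
congr dsum; apply/funext => i; apply/funext => j.
by rewrite /s -dpowE// /power_term !mxE /=; ring.
Unshelve. all: by end_near. Qed.

(** Exchanging the variables reduces the derivative in x_2 to the one in x_1. *)
Definition ftr a i j : R := a j i.

Lemma sqsum_tr (s : nat -> nat -> R) n : sqsum (fun i j => s j i) n = sqsum s n.
Proof. by rewrite /sqsum exchange_big. Qed.

Lemma ev_tr a (y z : R) : ev (ftr a) (row2 z y) = ev a (row2 y z).
Proof.
have E : sqsum (fun i j => power_term (ftr a) (row2 z y) (i, j)) =
         sqsum (fun i j => power_term a (row2 y z) (i, j)).
  apply/funext => n; rewrite -[RHS]sqsum_tr.
  apply: eq_bigr => i _; apply: eq_bigr => j _.
  by rewrite /power_term /ftr !mxE /= mulrAC.
by rewrite /ev /dsum E.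
Qed.

Lemma maj_tr K A a : maj K K A a -> maj K K A (ftr a).
Proof.
move=> ma i j; apply: le_trans (ma j i) _.
rewrite /wt addnC -!mulrA -!exprD addnC.
by rewrite -[in leRHS]bin_sub ?leq_addl// addnK addnC.
Qed.

Lemma partial_ev K A a x k : 0 < K -> maj K K A a ->
  (forall k, `|x 0 k| < (8 * K)^-1) ->
  partial (ev a) k x = ev (if k == 0 then dx a else dy a) x.
Proof.
move=> K0 ma xK; rewrite /partial /derive.
apply: cvg_lim => //; move: k; apply: ord2P => /=.
  have E t : t *: delta_mx 0 0 + x = row2 (x 0 0 + t) (x 0 1).
    by apply/rowP; apply: ord2P; rewrite !mxE /=; ring.
  rewrite (_ : (fun t => _) = fun t => t^-1 *
    (ev a (row2 (x 0 0 + t) (x 0 1)) - ev a (row2 (x 0 0) (x 0 1)))).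
    rewrite [X in ev (dx a) X]row2P.
    exact: (ev_dquot K0 ma (xK 0) (ltW (xK 1))).
  by apply/funext => t; rewrite E -row2P.
have E t : t *: delta_mx 0 1 + x = row2 (x 0 0) (x 0 1 + t).
  by apply/rowP; apply: ord2P; rewrite !mxE /=; ring.
rewrite (_ : (fun t => _) = fun t => t^-1 *
  (ev (ftr a) (row2 (x 0 1 + t) (x 0 0)) - ev (ftr a) (row2 (x 0 1) (x 0 0)))).
  have -> : ev (dy a) x = ev (dx (ftr a)) (row2 (x 0 1) (x 0 0)).
    by rewrite [X in ev (dy a) X]row2P -ev_tr.
  exact: (ev_dquot K0 (maj_tr ma) (xK 1) (ltW (xK 0))).
by apply/funext => t; rewrite E (ev_tr a (x 0 0) (x 0 1 + t)) (ev_tr a (x 0 0) (x 0 1)) -row2P.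
Qed.

End Derivative.

(** * The Cauchy-Kovalevskaya theorem *)

Section CauchyKovalevskaya.
Context {R : realType}.
Implicit Types (a b : nat -> nat -> R) (A B K L : R) (x : 'rV[R]_2).

Definition Iy a i j : R := if j is j'.+1 then a i j' / j'.+1%:R else 0.

(** One more degree costs at most a factor 4 in [lax], by (n + 2)^2 <= 4 (n + 1)^2, while the weight
    gains a factor [L]. *)
Lemma maj_Iy K L A a : 0 <= K -> 0 < L -> maj K L A a -> maj K L (A * (4 / L)) (Iy a).
Proof.
move=> K0 L0 ma i j; have A0 := maj_ge0 ma; have L1 := ltW L0.
have c0 : 0 <= A * (4 / L) by rewrite mulr_ge0 ?divr_ge0.
case: j => [|j] /=; first by rewrite normr0 mulr_ge0// wt_ge0.
have wS : wt K L i j <= 4 / L * wt K L i j.+1.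
  have -> : 4 / L * wt K L i j.+1 =
      4 * lax (i + j).+1 * ('C((i + j).+1, i)%:R * K ^+ i * L ^+ j).
    by rewrite /wt addnS [L ^+ j.+1]exprS; field; exact: lt0r_neq0.
  have h1 : lax (i + j) <= 4 * lax (i + j).+1 :> R.
    have t1 : 1 <= (i + j).+1%:R :> R by rewrite ler1n.
    rewrite /lax -[(i + j).+2%:R]natr1; move: (_.+1%:R) t1 => t t1.
    have t0 : 0 < t by lra.
    rewrite -div1r ler_pdivrMr ?mulr_gt0 ?exprn_gt0// mulrAC.
    by rewrite ler_pdivlMr ?mulr_gt0 ?exprn_gt0 ?addr_gt0//; nra.
  have h2 : 'C(i + j, i)%:R <= 'C((i + j).+1, i)%:R :> R by rewrite ler_nat leq_bin2l.
  have p1 := ltW (@lax_gt0 R (i + j)).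
  rewrite /wt; apply: ler_pM => //; first by rewrite !mulr_ge0 ?exprn_ge0.
  by rewrite ler_wpM2r ?exprn_ge0// ler_wpM2r ?exprn_ge0.
rewrite normrM normfV normr_nat ler_pdivrMr ?ltr0Sn//.
apply: le_trans (ma i j) _.
apply: (@le_trans _ _ (A * (4 / L) * wt K L i j.+1)).
  by rewrite -mulrA ler_wpM2l.
by rewrite ler_peMr ?ler1n// mulr_ge0// wt_ge0// ltW.
Qed.

(** The total degree is preserved, so the [lax] factors cancel; the factor i + 1 from
    differentiation and 1 / (j + 1) from integration cancel exactly against the ratio of binomials.
    This is what the binomials in [wt] are for: only K / L remains. *)
Lemma maj_Iydx K L A a : 0 < K -> 0 < L -> maj K L A a ->
  maj K L (A * (K / L)) (Iy (dx a)).
Proof.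
move=> K0 L0 ma i j; have A0 := maj_ge0 ma; have L1 := ltW L0; have K1 := ltW K0.
case: j => [|j] /=.
  by rewrite normr0 mulr_ge0// ?wt_ge0// mulr_ge0 ?divr_ge0.
rewrite /dx normrM normfV normrM !normr_nat ler_pdivrMr ?ltr0Sn//.
apply: le_trans (ler_wpM2l _ (ma i.+1 j)) _; first exact: ler0n.
have E : i.+1%:R * 'C((i + j).+1, i.+1)%:R = j.+1%:R * 'C((i + j).+1, i)%:R :> R.
  by rewrite -!natrM mul_bin_left -addnS addKn.
rewrite /wt addSn addnS [K ^+ i.+1]exprS [L ^+ j.+1]exprS.
rewrite le_eqVlt; apply/orP; left; apply/eqP.
transitivity (A * lax (i + j).+1 * (i.+1%:R * 'C((i + j).+1, i.+1)%:R) *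
  (K * K ^+ i * L ^+ j)); first by ring.
by rewrite E; field; exact: lt0r_neq0.
Qed.

(** Distinct weights serve the fixed point; evaluation of derivatives, as in [partial_ev], is stated
    for equal ones. *)
Lemma maj_le K L M A a : 0 <= K -> 0 <= L -> K <= M -> L <= M ->
  maj K L A a -> maj M M A a.
Proof.
move=> K0 L0 KM LM ma i j; apply: le_trans (ma i j) _.
rewrite ler_wpM2l ?(maj_ge0 ma)// /wt.
apply: ler_wpM2l; first exact/ltW/lax_gt0.
have M0 : 0 <= M by exact: le_trans KM.
by rewrite ler_pM ?mulr_ge0 ?exprn_ge0// ?ler_wpM2l// lerXn2r ?nnegrE.
Qed.

(* The formal series of the map with Cauchy data [p + (x_1, 0)] on [x_2 = 0]
   and [x_2]-derivative [w]. *)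
Definition ck_map (p : 'rV[R]_2) (w : 'I_2 -> nat -> nat -> R) k i j : R :=
  fcst (p 0 k) i j + ((if k == 0 then fvarx i j else 0) + Iy (w k) i j).

(* The index [(k, false)] stands for the [k]-th component of the map and
   [(k, true)] for its [x_1]-derivative. *)
Definition ck_point (p : 'rV[R]_2) (i : 'I_2 * bool) : R :=
  if i.2 then (i.1 == 0)%:R else p 0 i.1.

Theorem cauchy_kovalevskaya (p : 'rV[R]_2) (Phi : 'I_2 -> ('I_2 * bool -> R) -> R) :
  (forall k, lifts (Phi k) (ck_point p)) ->
  exists K A B w, [/\ 0 < K, forall k, maj K K A (w k),
    forall k, maj K K B (ck_map p w k) &
    forall x, small K K x -> forall k, ev (w k) x =
      Phi k (fun i => if i.2 then ev (dx (ck_map p w i.1)) x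
                      else ev (ck_map p w i.1) x)].
Proof.
set z := ck_point p => /choice[T HT].
have /choice[d1 Hd1] : forall k, exists d1, 0 < d1 /\
    forall K L u, 0 < K -> 0 < L -> (forall i, maj K L d1 (u i)) ->
        maj K L 1 (fun i j => T k u i j - fcst (Phi k z) i j) /\
        forall h, small K L h -> ev (T k u) h = Phi k (fun i => z i + ev (u i) h).
  by move=> k; have [d1 d10 H1] := (HT k).2 1 ltr01; exists d1; split.
pose d := Num.min (d1 0) (d1 1).
have d0 : 0 < d by rewrite lt_min (Hd1 0).1 (Hd1 1).1.
have {}Hd1 k K L u : 0 < K -> 0 < L -> (forall i, maj K L d (u i)) ->
        maj K L 1 (fun i j => T k u i j - fcst (Phi k z) i j) /\
        forall h, small K L h -> ev (T k u) h = Phi k (fun i => z i + ev (u i) h).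
  move=> K0 L0 mu; apply: (Hd1 k).2 => // i; apply: maj_wid (mu i); [exact: ltW|exact: ltW|].
  by move: k; apply: ord2P; rewrite ge_min lexx ?orbT.
(* The output of [T k] deviates by at most 1 from its constant term, whose norm is at most 16 |Phi k
   z|; the sum covers both components. *)
pose A := 1 + 16 * (`|Phi 0 z| + `|Phi 1 z|).
have A1 : 1 <= A by rewrite lerDl mulr_ge0 ?addr_ge0.
have AP k : 1 + 16 * `|Phi k z| <= A.
  by rewrite lerD2l ler_wpM2l//; move: k; apply: ord2P; rewrite ?lerDl ?lerDr.
pose K := 128 / d.
have K0 : 0 < K by rewrite divr_gt0.
have KE : 64 / K = d / 2 by rewrite /K; field; rewrite gt_eqF.
(* The three summands give K <= L, A (4 / L) <= d / 2 and A (K / L) <= d: the first for equalising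
   the weights at the end, the others for [Iy w] and [Iy (dx w)]. *)
pose L := K + (8 * A / d + K * A / d).
have A0 : 0 < A by lra.
have q1 : 0 < 8 * A / d by apply: divr_gt0 => //; exact: mulr_gt0.
have q2 : 0 < K * A / d by apply: divr_gt0 => //; exact: mulr_gt0.
have L0 : 0 < L by apply: addr_gt0 => //; exact: addr_gt0.
have KL : K <= L by rewrite lerDl addr_ge0 ?ltW.
have L1 : A * (4 / L) <= d / 2.
  have : 8 * A / d <= L by rewrite /L addrCA lerDl addr_ge0 ?ltW.
  rewrite ler_pdivrMr// mulrA ler_pdivrMr//; lra.
have L2 : A * (K / L) <= d.
  have : K * A / d <= L by rewrite /L addrA lerDr addr_ge0 ?ltW.
  rewrite ler_pdivrMr// mulrA ler_pdivrMr//; lra.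
(* Deviations of the map and of its x_1-derivative from their values [ck_point] at the origin. The
   derivative of x_1 itself is constant, hence absorbed there. *)
pose u (w : 'I_2 -> nat -> nat -> R) (i : 'I_2 * bool) : nat -> nat -> R :=
  if i.2 then Iy (dx (w i.1))
  else fun m n => (if i.1 == 0 then fvarx m n else 0) + Iy (w i.1) m n.
have K1 := ltW K0; have L1' := ltW L0.
have mvx k : maj K L (64 / K) (fun m n => if k == 0 :> 'I_2 then fvarx m n else 0).
  case: eqP => _; first exact: maj_fvarx.
  by move=> m n; rewrite normr0 mulr_ge0 ?wt_ge0// divr_ge0.
have mu w : (forall k, maj K L A (w k)) -> forall i, maj K L d (u w i).
  move=> mw [k []]; rewrite /u /=.
    exact: maj_wid L2 (maj_Iydx K0 L0 (mw k)).
  apply: maj_wid (maj_add (mvx k) (maj_Iy K1 L0 (mw k))) => //.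
  by rewrite KE; lra.
pose P (k : 'I_2) m n (r : R) := `|r| <= A * wt K L m n.
have [| | |w okw Tw] :=
  @causal_fixpoint R (fun _ j => j) P (fun w k => T k (u w)) (fun _ _ _ => 0).
- by move=> k m n; rewrite /P normr0 mulr_ge0 ?wt_ge0 ?ltW.
- move=> w okw k; apply: maj_wid (AP k) _ => //.
  have [m1 _] := Hd1 k K L (u w) K0 L0 (mu w okw).
  exact: (maj_from_sub m1 (maj_fcst _ K1 L1')).
(* Both kinds of input contain [w] only under [Iy], which raises the x_2-degree by one. *)
- move=> n w w' _ _ ww' k; apply: (HT k).1; first by [].
  move=> [l []] m [|j] jn; rewrite /u /= ?/dx ?ww'//.
have mw k : maj K L A (w k) by exact: okw.
have mF k : maj K L (16 * `|p 0 k| + (64 / K + A * (4 / L))) (ck_map p w k).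
  exact: (maj_add (maj_fcst _ K1 L1') (maj_add (mvx k) (maj_Iy K1 L0 (mw k)))).
have lL q B a : maj K L B a -> B <= q -> maj L L q a.
  move=> ma Bq; apply: (maj_wid L1' L1' Bq).
  exact: (maj_le K1 L1' KL (lexx _) ma).
exists L, A, (16 * `|p 0 0| + 16 * `|p 0 1| + (64 / K + A * (4 / L))), w; split => //.
- by move=> k; exact: lL (mw k) _.
- by move=> k; apply: lL (mF k) _; move: k; apply: ord2P; rewrite lerD2r ?lerDl ?lerDr mulr_ge0.
move=> x sx k.
have sx' : small K L x.
  by move=> l; apply: le_trans (sx l); rewrite ler_wpM2l// lerD2r.
rewrite -{1}Tw (Hd1 k K L _ K0 L0 (mu w okw)).2//; congr (Phi k _).
apply/funext => -[l []]; rewrite /z /ck_point /u /=.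
  have dF : dx (ck_map p w l) = fun m n => fcst (l == 0)%:R m n + Iy (dx (w l)) m n.
    apply/funext => m; apply/funext => n; rewrite /dx /ck_map /fcst /fvarx /=.
    case: n => [|n] /=.
      by case: m => [|m] /=; case: (l == 0); rewrite /= ?mulr0 ?addr0 ?add0r ?mulr1 ?mulr0.
    by case: m => [|m] /=; case: (l == 0); rewrite /= ?addr0 ?add0r mulrA.
  by rewrite dF (ev_add K1 L1' sx' (maj_fcst _ K1 L1') (maj_Iydx K0 L0 (mw l))) ev_fcst.
rewrite /ck_map (ev_add K1 L1' sx' (maj_fcst _ K1 L1') (mu w mw (l, false))) ev_fcst.
by [].
Qed.

End CauchyKovalevskaya.

(** * Local normal form of a metric *)

Section NormalCoordinates.
Context {R : realType}.
Implicit Types (p x y : 'rV[R]_2) (f : 'rV[R]_2 -> R).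

(** * Lifting arithmetic operations *)

Lemma lifts_ext (I : Type) (s t : (I -> R) -> R) z :
  (forall w, s w = t w) -> lifts s z -> lifts t z.
Proof. by move=> /funext ->. Qed.

(** A binary operation is an analytic function of two variables, so [lifts_comp] covers it whatever
    the index type [I]; nesting such operations reaches the four arguments of [Phi]. *)
Lemma lifts_op (I : Type) (op : R -> R -> R) (s t : (I -> R) -> R) z :
  (forall p, p 0 0 = s z -> p 0 1 = t z -> analytic_at (fun x => op (x 0 0) (x 0 1)) p) ->
  lifts s z -> lifts t z -> lifts (fun w => op (s w) (t w)) z.
Proof.
move=> aop ls lt; pose u (k : 'I_2) := if k == 0 then s else t.
have := @lifts_comp R I (fun x => op (x 0 0) (x 0 1)) u z.
rewrite /u => H; apply: (lifts_ext _ (H _ _)) => [w||].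
- by rewrite !mxE.
- by apply: aop; rewrite mxE.
- exact: ord2P.
Qed.

Lemma lifts_add (I : Type) (s t : (I -> R) -> R) z :
  lifts s z -> lifts t z -> lifts (fun w => s w + t w) z.
Proof.
by apply: lifts_op => p _ _; apply: analytic_add; exact: analytic_coord.
Qed.

Lemma lifts_mul (I : Type) (s t : (I -> R) -> R) z :
  lifts s z -> lifts t z -> lifts (fun w => s w * t w) z.
Proof.
by apply: lifts_op => p _ _; apply: analytic_mul; exact: analytic_coord.
Qed.

Lemma lifts_inv (I : Type) (s : (I -> R) -> R) z :
  s z != 0 -> lifts s z -> lifts (fun w => (s w)^-1) z.
Proof.
move=> s0 ls; apply: (lifts_op (op := fun a b => a^-1) _ ls ls) => p sp _.
by apply: analytic_inv; rewrite ?sp//; exact: analytic_coord.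
Qed.

Lemma lifts_fun f p : analytic_at f p ->
  lifts (fun w : 'I_2 * bool -> R => f (\row_k w (k, false))) (ck_point p).
Proof.
move=> af; apply: (lifts_comp (t := fun k w => w (k, false))) => [|k].
  by rewrite (_ : \row_k _ = p)//; apply/rowP => k; rewrite mxE.
exact: lifts_proj.
Qed.

Lemma bnd_dx C S (a : nat -> nat -> R) : 0 < S -> bnd C S a ->
  bnd (C * S) (2 * S) (dx a).
Proof.
move=> S0 ba i j; rewrite /dx normrM normr_nat.
have C0 := bnd_ge0 ba.
apply: le_trans (ler_wpM2l (ler0n _ _) (ba i.+1 j)) _.
rewrite addSn exprS exprMn.
have -> : i.+1%:R * (C * (S * S ^+ (i + j))) = C * S * (i.+1%:R * S ^+ (i + j)) by ring.
apply: ler_wpM2l; first by rewrite mulr_ge0// ltW.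
apply: ler_wpM2r; first by rewrite exprn_ge0// ltW.
rewrite -natrX ler_nat; apply: leq_trans (ltn_expl i (isT : (1 < 2)%N)) _.
by rewrite leq_exp2l// leq_addr.
Qed.

Lemma dy_ck_map p w k : dy (@ck_map R p w k) = w k.
Proof.
apply/funext => i; apply/funext => j; rewrite /dy /ck_map /fcst /fvarx /=.
have -> : (if k == 0 then if (i, j.+1) == (1, 0)%N then 1 else 0 else 0) = 0 :> R.
  by rewrite !xpair_eqE andbF if_same.
by rewrite xpair_eqE andbF !add0r mulrC divfK// pnatr_eq0.
Qed.

Theorem normal_coordinates (c : R) (e f h : 'rV[R]_2 -> R) p :
  c != 0 -> analytic_at e p -> analytic_at f p -> analytic_at h p ->
  0 < e p -> 0 < e p * h p - f p * f p ->
  exists F G : 'rV[R]_2 -> 'rV[R]_2,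
    [/\ F 0 = p, forall k, analytic_at (fun x => F x 0 k) 0,
     forall k, analytic_at (fun x => G x 0 k) p,
     (\forall x \near (0 : 'rV[R]_2), G (F x) = x) /\
     (\forall y \near p, F (G y) = y) &
     \forall x \near (0 : 'rV[R]_2),
       let P k := partial (fun x => F x 0 k) 0 x in
       let Q k := partial (fun x => F x 0 k) 1 x in
       let y := F x in
       e y * P 0 * Q 0 + f y * (P 0 * Q 1 + P 1 * Q 0) + h y * P 1 * Q 1 = 0 /\
       (P 0 * Q 1 - P 1 * Q 0) ^+ 2 * (e y * h y - f y * f y) = c ^+ 2].
Proof.
move=> c0 ae af ah ep Dp.
pose D x := e x * h x + -1 * (f x * f x).
have DE x : D x = e x * h x - f x * f x by rewrite /D mulN1r.
have aD : analytic_at D p.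
  apply: analytic_add; first exact: analytic_mul.
  by apply: analytic_mul; [exact: analytic_cst|exact: analytic_mul].
have D0 : 0 < D p by rewrite DE.
pose kap x := c * (Num.sqrt (D x))^-1.
have akap : analytic_at kap p.
  apply: analytic_mul; first exact: analytic_cst.
  by apply: analytic_inv; [exact: analytic_sqrt|rewrite gt_eqF// sqrtr_gt0].
pose V (w : 'I_2 * bool -> R) : 'rV[R]_2 := \row_k w (k, false).
pose E (w : 'I_2 * bool -> R) :=
  e (V w) * (w (0, true) * w (0, true)) +
  (2 * (f (V w) * (w (0, true) * w (1, true))) + h (V w) * (w (1, true) * w (1, true))).
have Vp : V (ck_point p) = p by apply/rowP => k; rewrite mxE.
have Ep : E (ck_point p) = e p by rewrite /E Vp /ck_point /=; ring.
have lw i : lifts (fun w : 'I_2 * bool -> R => w i) (ck_point p) by exact: lifts_proj.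
have lE : lifts E (ck_point p).
  apply: lifts_add; first by apply: lifts_mul; [exact: lifts_fun|exact: lifts_mul].
  apply: lifts_add; last by apply: lifts_mul; [exact: lifts_fun|exact: lifts_mul].
  apply: lifts_mul; first exact: lifts_cst.
  by apply: lifts_mul; [exact: lifts_fun|exact: lifts_mul].
pose N (k : 'I_2) (w : 'I_2 * bool -> R) :=
  if k == 0 then -1 * (f (V w) * w (0, true) + h (V w) * w (1, true))
  else e (V w) * w (0, true) + f (V w) * w (1, true).
have lN k : lifts (N k) (ck_point p).
  move: k; apply: ord2P; rewrite /N /=.
    apply: lifts_mul; first exact: lifts_cst.
    by apply: lifts_add; apply: lifts_mul => //; exact: lifts_fun.
  by apply: lifts_add; apply: lifts_mul => //; exact: lifts_fun.
pose Phi k w := N k w * (kap (V w) * (E w)^-1).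
have lPhi k : lifts (Phi k) (ck_point p).
  apply: lifts_mul => //; apply: lifts_mul; first exact: lifts_fun.
  by apply: lifts_inv => //; rewrite Ep gt_eqF.
have [K [A [B [w [K0 mw mF wE]]]]] := cauchy_kovalevskaya lPhi.
pose F x : 'rV[R]_2 := \row_k ev (ck_map p w k) x.
have sF k : has_series (fun x => F x 0 k) 0 (ck_map p w k).
  have K2 : 0 < 2 * K by rewrite mulr_gt0.
  have := bnd_series K2 (maj_bnd K0 (mF k)).
  by congr has_series; apply/funext => x; rewrite mxE.
have aF k : analytic_at (fun x => F x 0 k) 0 by exists (ck_map p w k); exact: sF.
have F0 : F 0 = p.
  apply/rowP => k; rewrite mxE ev_at0 /ck_map /fcst /= /fvarx /=.
  by rewrite if_same !addr0.
pose P k x := ev (dx (ck_map p w k)) x.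
have aP k : analytic_at (P k) 0.
  have S0 : 0 < 2 * (2 * K) by rewrite !mulr_gt0.
  have S1 : 0 < 2 * K by rewrite mulr_gt0.
  by exists (dx (ck_map p w k)); exact: bnd_series S0 (bnd_dx S1 (maj_bnd K0 (mF k))).
have P0 k : P k 0 = (k == 0)%:R.
  rewrite /P ev_at0 /dx /ck_map /fcst /= /fvarx /= addr0 mul1r add0r.
  by case: (k == 0).
pose W x (i : 'I_2 * bool) := if i.2 then P i.1 x else F x 0 i.1.
have VW x : V (W x) = F x by apply/rowP => k; rewrite mxE.
have W0 : W 0 = ck_point p.
  by apply/funext => -[k []]; rewrite /W /ck_point /= ?P0 ?F0.
have aV g : analytic_at g p -> analytic_at (fun x => g (V (W x))) 0.
  move=> ag; apply: (analytic_ext (f := fun x => g (\row_k F x 0 k))).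
    by move=> x; rewrite VW; congr g; apply/rowP => k; rewrite mxE.
  apply: analytic_comp; last exact: aF.
  rewrite (_ : \row_k _ = p)//.
  by rewrite -F0; apply/rowP => k; rewrite mxE.
have aE : analytic_at (fun x => E (W x)) 0.
  rewrite /E; apply: analytic_add.
    by apply: analytic_mul; [exact: aV|apply: analytic_mul; exact: aP].
  apply: analytic_add.
    apply: analytic_mul; first exact: analytic_cst.
    by apply: analytic_mul; [exact: aV|apply: analytic_mul; exact: aP].
  by apply: analytic_mul; [exact: aV|apply: analytic_mul; exact: aP].
have E0 : \forall x \near (0 : 'rV[R]_2), 0 < E (W x).
  by apply: near_gt0 aE _; rewrite W0 Ep.
have Dn : \forall x \near (0 : 'rV[R]_2), 0 < D (V (W x)).
  by apply: near_gt0; [exact: aV|rewrite W0 Vp].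
have sm0 : small K K (0 : 'rV[R]_2).
  by move=> k; rewrite mxE normr0 mul0r invr_ge0.
(* At the origin F_1 = (1, 0), so the Jacobian determinant of [F] is the second component of F_2,
   namely [kap p] = c / sqrt (D p). *)
have w1 : w 1 0%N 0%N != 0.
  rewrite -ev_at0 wE//; set v := (fun i => _).
  have -> : v = ck_point p.
    by rewrite -W0; apply/funext => -[k []]; rewrite /v /W /= ?mxE.
  rewrite /Phi /N /= Ep Vp /ck_point /=.
  have e0 : e p != 0 by rewrite gt_eqF.
  rewrite mulr1 mulr0 addr0; apply: mulf_neq0 => //.
  apply: mulf_neq0; last by rewrite invr_neq0.
  by apply: mulf_neq0 => //; rewrite invr_neq0// gt_eqF// sqrtr_gt0.
have uA : (\matrix_(j < 2, k < 2) ck_map p w k (1 - j)%N j) \in unitmx.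
  rewrite unitmxE det2 !mxE unitfE /ck_map /fcst /fvarx /=.
  by rewrite !(addr0, add0r, mul0r, subr0, mul1r) divr1.
have [G [_ aG GF FG]] := inverse_function sF uA.
rewrite F0 in aG FG.
exists F, G; split => //.
near=> x.
have sx : small K K x by rewrite -[x]subr0; near: x; exact: near_small.
(* The 9 turns the non-strict bound of [near_coord] into the strict one that [partial_ev] asks for
   with 8. *)
have x9 : forall k, `|(x - 0) 0 k| <= (9 * K)^-1.
  by near: x; apply: near_coord; rewrite invr_gt0 mulr_gt0.
have x8 k : `|x 0 k| < (8 * K)^-1.
  have := x9 k; rewrite subr0 => /le_lt_trans; apply.
  by rewrite ltf_pV2 ?posrE ?mulr_gt0// ltr_pM2r// ltr_nat.
have PE k : partial (fun x => F x 0 k) 0 x = P k x.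
  rewrite (_ : (fun x => F x 0 k) = ev (ck_map p w k)).
    by rewrite (partial_ev 0 K0 (mF k) x8).
  by apply/funext => z; rewrite mxE.
have QE k : partial (fun x => F x 0 k) 1 x = Phi k (W x).
  rewrite (_ : (fun x => F x 0 k) = ev (ck_map p w k)).
    rewrite (partial_ev 1 K0 (mF k) x8) /= dy_ck_map wE//; congr (Phi k _).
    by apply/funext => -[l []]; rewrite /W /= ?mxE.
  by apply/funext => z; rewrite mxE.
have Ex : 0 < E (W x) by near: x.
have Dx : 0 < D (V (W x)) by near: x.
rewrite !PE !QE /Phi -DE -VW.
(* F_2 is [t] times [N], whose determinant with F_1 is [E]; thus det DF = [t * E] = [kap], and kap^2
   D = c^2. *)
set t := kap _ * _.
have tE : t * E (W x) = kap (V (W x)) by rewrite /t mulfVK// gt_eqF.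
have kD : kap (V (W x)) ^+ 2 * D (V (W x)) = c ^+ 2.
  rewrite /kap exprMn exprVn sqr_sqrtr ?ltW// mulfVK// gt_eqF//.
rewrite -kD -tE /N /E /= /W /=.
split; ring.
Unshelve. all: by end_near. Qed.

End NormalCoordinates.

(** * Charts *)

Section Charts.
Context {R : realType}.

Lemma within_openP (S T : topologicalType) (A : set S) (f : S -> T) : open A ->
  {within A, continuous f} <-> forall x, A x -> {for x, continuous f}.
Proof. by move=> oA; rewrite continuous_open_subspace// in_setP. Qed.

Lemma sub_chart (M : topologicalType) (psi : chart R M)
    (F G : 'rV[R]_2 -> 'rV[R]_2) (V W : set 'rV[R]_2) :
  open V -> open W -> V `<=` chart_cod psi ->
  (forall x, W x -> V (F x) /\ G (F x) = x) ->
  (forall y, V y -> W (G y) /\ F (G y) = y) ->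
  (forall x, W x -> {for x, continuous F}) ->
  (forall y, V y -> {for y, continuous G}) ->
  exists phi : chart R M,
    [/\ chart_dom phi = chart_dom psi `&` chart_map psi @^-1` V,
        chart_map phi = G \o chart_map psi,
        chart_inv phi = chart_inv psi \o F & chart_cod phi = W].
Proof.
move=> oV oW Vcod WV VW cF cG.
have od := chart_dom_open psi; have oc := @chart_cod_open _ _ psi.
have cm := (within_openP _ od).1 (@chart_map_continuous _ _ psi).
have ci := (within_openP _ oc).1 (@chart_inv_continuous _ _ psi).
pose D := chart_dom psi `&` chart_map psi @^-1` V.
have oD : open D.
  rewrite openE => m [dm Vm]; rewrite /interior.
  apply: filterI; first exact: open_nbhs_nbhs.
  by apply: (cm m dm); exact: open_nbhs_nbhs.
have codE : (G \o chart_map psi) @` D = W.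
  apply/seteqP; split => [_ [m [dm Vm] <-]|x Wx]; first exact: (VW _ Vm).1.
  have [VF GF] := WV x Wx; have [m dm mE] := Vcod _ VF.
  by exists m; rewrite /D /= ?mE.
have oG : open ((G \o chart_map psi) @` D) by rewrite codE.
have cmap : {within D, continuous (G \o chart_map psi)}.
  apply/(within_openP _ oD) => m [dm Vm].
  by apply: continuous_comp; [exact: cm|exact: cG].
have cinv : {within (G \o chart_map psi) @` D, continuous (chart_inv psi \o F)}.
  apply/(within_openP _ oG); rewrite codE => x Wx; have [VF _] := WV x Wx.
  by apply: continuous_comp; [exact: cF|apply: ci; exact: Vcod].
have mK m : D m -> (chart_inv psi \o F) ((G \o chart_map psi) m) = m.
  by move=> [dm Vm] /=; rewrite (VW _ Vm).2; exact: chart_mapK.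
by exists (Chart oD oG cmap cinv mK); split.
Qed.

Lemma row_eta (F : 'rV[R]_2 -> 'rV[R]_2) x : \row_k F x 0 k = F x.
Proof. by apply/rowP => k; rewrite mxE. Qed.

Lemma sub_chart_compatible (M : topologicalType) (psi chi phi : chart R M)
    (F G : 'rV[R]_2 -> 'rV[R]_2) (V W : set 'rV[R]_2) :
  compatible psi chi ->
  chart_dom phi = chart_dom psi `&` chart_map psi @^-1` V ->
  chart_map phi = G \o chart_map psi -> chart_inv phi = chart_inv psi \o F ->
  (forall y, V y -> W (G y) /\ F (G y) = y) ->
  (forall x k, W x -> analytic_at (fun x => F x 0 k) x) ->
  (forall y k, V y -> analytic_at (fun y => G y 0 k) y) ->
  compatible phi chi.
Proof.
move=> pc dE mE iE VW aF aG i; split.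
  move=> _ [m [+ cm] <-]; rewrite dE mE => -[dm Vm] /=.
  have [WG FG] := VW _ Vm.
  have at_ : analytic_at (fun y => transition psi chi y 0 i) (chart_map psi m).
    by apply: (pc i).1; exists m.
  have := @analytic_comp R (fun y => transition psi chi y 0 i) (fun k x => F x 0 k)
    (G (chart_map psi m)).
  rewrite row_eta FG => /(_ at_ (fun k => aF _ k WG)).
  by apply: analytic_ext => x; rewrite row_eta /transition iE.
move=> _ [m [cm +] <-]; rewrite dE => -[dm Vm].
have E : transition chi psi (chart_map chi m) = chart_map psi m.
  by rewrite /transition /= chart_mapK.
have := @analytic_comp R (fun y => G y 0 i) (fun k => fun x => transition chi psi x 0 k)
  (chart_map chi m).
rewrite row_eta E => /(_ (aG _ i Vm)) H.
have {}H : analytic_at (fun x => G (\row_k transition chi psi x 0 k) 0 i) (chart_map chi m).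
  by apply: H => k; apply: (pc k).2; exists m.
by apply: analytic_ext H => x; rewrite row_eta /transition mE.
Qed.

Definition normal_chart (M : analytic_surface R) (g : riemannian_metric M) (c : R)
    (phi : chart R M) :=
  analytic_chart phi /\
  forall x, chart_cod phi x -> g phi x 0 1 = 0 /\ \det (g phi x) = c ^+ 2.

Lemma metric_symE (M : analytic_surface R) (g : riemannian_metric M)
    (phi : chart R M) x :
  analytic_chart phi -> chart_cod phi x -> g phi x 1 0 = g phi x 0 1.
Proof.
by move=> aphi cx; rewrite -{1}(Defs.metric_sym g aphi cx) mxE.
Qed.

Lemma quadE (A : 'M[R]_2) (v : 'cV[R]_2) :
  (v^T *m A *m v) 0 0 =
  A 0 0 * v 0 0 ^+ 2 + (A 0 1 + A 1 0) * (v 0 0 * v 1 0) + A 1 1 * v 1 0 ^+ 2.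
Proof.
have s2 (f : 'I_2 -> R) : \sum_i f i = f 0 + f 1.
  rewrite !big_ord_recl big_ord0 addr0; congr (_ + f _); exact: val_inj.
by rewrite !mxE s2 !mxE !s2 !mxE; ring.
Qed.

Lemma metric_pos (M : analytic_surface R) (g : riemannian_metric M)
    (phi : chart R M) x : analytic_chart phi -> chart_cod phi x ->
  [/\ 0 < g phi x 0 0, 0 < g phi x 1 1 & 0 < \det (g phi x)].
Proof.
move=> aphi cx; have pd := metric_posdef g aphi cx.
have nz (v : 'cV[R]_2) i : v i 0 != 0 -> v != 0.
  by apply: contraNneq => ->; rewrite mxE.
pose col2 (r s : R) : 'cV[R]_2 := \col_k (if k == 0 then r else s).
have g00 : 0 < g phi x 0 0.
  have := pd (col2 1 0) (nz _ 0 _); rewrite quadE !mxE /= oner_neq0 => /(_ isT).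
  by rewrite expr1n mulr1 mulr0 mulr0 addr0 expr0n mulr0 addr0.
have g11 : 0 < g phi x 1 1.
  have := pd (col2 0 1) (nz _ 1 _); rewrite quadE !mxE /= oner_neq0 => /(_ isT).
  by rewrite expr1n mul0r mulr0 mulr1 expr0n mulr0 !add0r.
split => //; set a := g phi x 0 0 in g00; set b := g phi x 0 1.
(* At (-b, a) the quadratic form equals a (a d - b^2), that is [a] times the determinant. *)
have := pd (col2 (- b) a) (nz _ 1 _); rewrite quadE !mxE /= gt_eqF// => /(_ isT).
rewrite det2 (metric_symE g aphi cx) -/a -/b.
set d := g phi x 1 1 => h; rewrite -(pmulr_rgt0 _ g00).
by move: h; congr (0 < _); ring.
Qed.

Lemma normal_charts_cover (M : analytic_surface R) (g : riemannian_metric M) (c : R) :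
  c != 0 -> covers (normal_chart g c).
Proof.
move=> c0 m; have [psi spsi dm] := @surface_atlas_covers R M m.
have apsi : analytic_chart psi by move=> chi; exact: surface_atlas_compatible.
set p := chart_map psi m.
have cp : chart_cod psi p by exists m.
have [e0 _ D0] := metric_pos g apsi cp.
have ag i j : analytic_at (fun x => g psi x i j) p by exact: metric_analytic.
have D0' : 0 < g psi p 0 0 * g psi p 1 1 - g psi p 0 1 * g psi p 0 1.
  by move: D0; rewrite det2 (metric_symE g apsi cp).
have [F [G [F0 aF aG [GF FG] N]]] :=
  normal_coordinates c0 (ag 0 0) (ag 0 1) (ag 1 1) e0 D0'.
pose good x := [/\ analytic_at (fun x => F x 0 0) x, analytic_at (fun x => F x 0 1) x,
  G (F x) = x &
  let P k := partial (fun x => F x 0 k) 0 x in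
  let Q k := partial (fun x => F x 0 k) 1 x in
  let y := F x in
  g psi y 0 0 * P 0 * Q 0 + g psi y 0 1 * (P 0 * Q 1 + P 1 * Q 0) +
    g psi y 1 1 * P 1 * Q 1 = 0 /\
  (P 0 * Q 1 - P 1 * Q 0) ^+ 2 *
    (g psi y 0 0 * g psi y 1 1 - g psi y 0 1 * g psi y 0 1) = c ^+ 2].
have goodn : \forall x \near (0 : 'rV[R]_2), good x.
  have a0 := analytic_near (aF 0); have a1 := analytic_near (aF 1).
  by near=> x; split; near: x.
pose good' y := [/\ analytic_at (fun y => G y 0 0) y, analytic_at (fun y => G y 0 1) y,
  F (G y) = y & chart_cod psi y].
have goodn' : \forall y \near p, good' y.
  have a0 := analytic_near (aG 0); have a1 := analytic_near (aG 1).
  have cn : \forall y \near p, chart_cod psi y.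
    by apply: open_nbhs_nbhs; split => //; exact: chart_cod_open.
  by near=> y; split; near: y.
pose W0 := interior good; pose V0 := interior good'.
have sW0 : W0 `<=` good by exact: interior_subset.
have sV0 : V0 `<=` good' by exact: interior_subset.
have caF x k : W0 x -> analytic_at (fun x => F x 0 k) x.
  by move=> /sW0[a0 a1 _ _]; move: k; apply: ord2P.
have caG y k : V0 y -> analytic_at (fun y => G y 0 k) y.
  by move=> /sV0[a0 a1 _ _]; move: k; apply: ord2P.
have cF x : W0 x -> {for x, continuous F}.
  by move=> Wx; apply: row_continuous => k; apply: analytic_continuous; exact: caF.
have cG y : V0 y -> {for y, continuous G}.
  by move=> Vy; apply: row_continuous => k; apply: analytic_continuous; exact: caG.
(* The two interiors need not map into each other; cutting each by the preimage of the other makes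
   [F] and [G] mutually inverse between [W] and [V]. *)
pose W := W0 `&` F @^-1` V0; pose V := V0 `&` G @^-1` W0.
have oW : open W.
  rewrite openE => x [Wx Vx]; apply: filterI.
    by apply: open_nbhs_nbhs; split => //; exact: open_interior.
  by apply: (cF x Wx); apply: open_nbhs_nbhs; split => //; exact: open_interior.
have oV : open V.
  rewrite openE => y [Vy Wy]; apply: filterI.
    by apply: open_nbhs_nbhs; split => //; exact: open_interior.
  by apply: (cG y Vy); apply: open_nbhs_nbhs; split => //; exact: open_interior.
have WV x : W x -> V (F x) /\ G (F x) = x.
  by move=> [Wx Vx]; have [_ _ E _] := sW0 _ Wx; split => //; split => //; rewrite /= E.
have VW y : V y -> W (G y) /\ F (G y) = y.
  by move=> [Vy Wy]; have [_ _ E _] := sV0 _ Vy; split => //; split => //; rewrite /= E.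
have Vc : V `<=` chart_cod psi by move=> y [/sV0[]].
have Vp : V p.
  split; first exact: goodn'.
  have Gp : G p = 0 by rewrite -F0; exact: (nbhs_singleton GF).
  by rewrite /= Gp; exact: goodn.
have [phi [dE mE iE codE]] := sub_chart oV oW Vc WV VW
  (fun x (Wx : W x) => cF x Wx.1) (fun y (Vy : V y) => cG y Vy.1).
have aphi : analytic_chart phi.
  move=> chi achi; apply: (sub_chart_compatible (V := V) (W := W)) dE mE iE VW _ _.
  - exact: apsi.
  - by move=> x k [Wx _]; exact: caF.
  - by move=> y k [Vy _]; exact: caG.
exists phi; last by rewrite dE.
split => // x cx.
have Wx : W x by rewrite -codE.
(* The transition map is total and its values are controlled on [W]; as [W] is open, the equality
   holds near [x] and hence for the derivatives. *)
have tE : \forall z \near x, transition phi psi z = F z.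
  near=> z; have Wz : W z by near: z; exact: open_nbhs_nbhs.
  have [/Vc[n dn nE] _] := WV z Wz.
  by rewrite /transition iE /= -nE chart_mapK.
have ox : overlap phi psi x.
  move: cx => [n dn nE]; exists n => //; split => //.
  by move: dn; rewrite dE => -[].
have JE k j : Dmx (transition phi psi) x k j = partial (fun x => F x 0 k) j x.
  rewrite mxE /partial; apply: near_eq_derive; near=> z.
  by have -> : transition phi psi z = F z by near: z.
have [_ _ _ /= [N1 N2]] := sW0 _ Wx.1.
have gE := metric_change g aphi apsi ox; rewrite (nbhs_singleton tE) in gE.
have s2 (f : 'I_2 -> R) : \sum_i f i = f 0 + f 1.
  rewrite !big_ord_recl big_ord0 addr0; congr (_ + f _); exact: val_inj.
have cFx : chart_cod psi (F x) by apply: Vc; exact: (WV x Wx).1.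
have gs := metric_symE g apsi cFx.
split.
  rewrite gE -N1 !mxE s2 !mxE !s2 !mxE -!JE !mxE gs; ring.
rewrite gE !det_mulmx det_tr -N2 !det2 gs -!JE; ring.
Unshelve. all: by end_near. Qed.

End Charts.

Theorem theorem2 (R : realType) (c : R) (hc : c != 0)
    (M : analytic_surface R) (g : riemannian_metric M) :
  exists A : set (chart R M),
    is_atlas A /\
    forall phi : chart R M, A phi ->
      (exists eps : 'rV[R]_2 -> R,
         analytic_on (chart_cod phi) eps /\
         forall x, chart_cod phi x ->
           eps x != 0 /\
           g phi x = (c ^+ 2 / eps x) *: delta_mx 0 0
                     + eps x *: delta_mx 1 1) /\
      (forall (N : nat) (iota : M -> 'rV[R]_N),
         isometric_embedding g (chart_dom phi) iota ->
         let F := iota \o chart_inv phi in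
         (forall x, chart_cod phi x ->
            is_diag_mx ((Dmx F x)^T *m Dmx F x) /\
            (Dmx F x)^T *m Dmx F x \in unitmx) /\
         (exists2 k : R, k != 0 &
            forall x, chart_cod phi x ->
              \det ((Dmx F x)^T *m Dmx F x) = k ^+ 2)).
Proof.
exists (normal_chart g c); split.
  by split; [move=> phi []|exact: normal_charts_cover].
move=> phi [aphi nphi]; split.
  exists (fun x => g phi x 1 1); split; first exact: metric_analytic.
  move=> x cx; have [_ g11 _] := metric_pos g aphi cx.
  have [g01] := nphi x cx; rewrite det2 (metric_symE g aphi cx) g01 mul0r subr0 => gd.
  split; first by rewrite gt_eqF.
  apply/matrixP => i j; rewrite -gd mulfK ?gt_eqF//.
  by move: i j; apply: ord2P; apply: ord2P; rewrite !mxE /= ?(metric_symE g aphi cx) ?g01;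
    rewrite ?(mulr0, mulr1, addr0, add0r).
move=> N iota iso F.
(* The pullback condition read in [phi] itself identifies the Gram matrix with [g phi], so both
   properties are those of the normal form, with k = c. *)
have FE x : chart_cod phi x -> (Dmx F x)^T *m Dmx F x = g phi x.
  by move=> cx; apply: (isometric_pullback iso) => //; rewrite setIid.
split => [x cx|]; last by exists c => // x cx; rewrite FE// (nphi x cx).2.
rewrite FE//; have [g01 gd] := nphi x cx; split.
  apply/is_diag_mxP; apply: ord2P; apply: ord2P => //= _.
  by rewrite (metric_symE g aphi cx).
by rewrite unitmxE gd unitfE expf_neq0.
Qed.
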